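(* (1) The $\Bbbk\mathbf{G}$-module $\operatorname{Ind}_{\mathbf N}^{\mathbf G}\Bbbk_{+}$ has a unique simple quotient module (that is, a unique maximal submodule), and this quotient is isomorphic to the trivial $\Bbbk\mathbf{G}$-module $\Bbbk_{\mathrm{tr}}$. The $\Bbbk\mathbf{G}$-module $\operatorname{Ind}_{\mathbf N}^{\mathbf G}\Bbbk_{-}$ has a unique simple quotient module, and this quotient is isomorphic to the Steinberg module $\mathrm{St}$. (2) If $\theta\in\widehat{\mathbf T}$ is nontrivial, then $\operatorname{Ind}_{\mathbf T}^{\mathbf G}\Bbbk_\theta$ has exactly two simple quotient modules, namely $\mathbb{M}(\theta)$ and $\mathbb{M}(\theta^s)$.
   Context: Let $\mathbb{F}_q$ be a finite field with $q$ elements, $\bar{\mathbb{F}}_q$ its algebraic closure, and $\Bbbk$ an algebraically closed field of characteristic $0$. Let $\mathbf G=SL_2(\bar{\mathbb F}_q)$, regarded as an abstract group, with $\Bbbk\mathbf G$ its group algebra. Let $\mathbf T$ be the subgroup of diagonal matrices, $\mathbf B$ the subgroup of upper triangular matrices, $\mathbf N=N_{\mathbf G}(\mathbf T)$, $W=\mathbf N/\mathbf T=\{1,s\}$, with $s$ represented by $\dot s=\begin{pmatrix}0&1\\-1&0\end{pmatrix}$. Let $\widehat{\mathbf T}$ be the set of all (abstract) group homomorphisms $\mathbf T\to\Bbbk^*$. Write $\Bbbk_\theta$ for the one-dimensional $\mathbf T$-module given by $\theta\in\widehat{\mathbf T}$, also regarded as a $\mathbf B$-module via the projection $\mathbf B\to\mathbf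 T$. Set $\theta^s(t)=\theta(\dot s^{-1}t\dot s)$. For a subgroup $\mathbf H\le\mathbf K$, $\operatorname{Ind}_{\mathbf H}^{\mathbf K}V=\Bbbk\mathbf K\otimes_{\Bbbk\mathbf H}V$. Put $\mathbb M(\theta)=\operatorname{Ind}_{\mathbf B}^{\mathbf G}\Bbbk_\theta=\Bbbk\mathbf G\otimes_{\Bbbk\mathbf B}\Bbbk_\theta$, and let $\mathrm{tr}$ denote the trivial character. The Steinberg module $\mathrm{St}$ is the submodule of $\mathbb M(\mathrm{tr})$ generated by $\eta_s=(1-\dot s)\mathbf 1_{\mathrm{tr}}$, where $\mathbf 1_{\mathrm{tr}}$ is a nonzero element of $\Bbbk_{\mathrm{tr}}$ (viewed in $\mathbb M(\mathrm{tr})$ as $1\otimes\mathbf 1_{\mathrm{tr}}$). $\Bbbk_+$ is the trivial one-dimensional representation of $\mathbf N$, and $\Bbbk_-$ is the sign representation of $W$ (with $s\mapsto -1$) regarded as a representation of $\mathbf N$ via $\mathbf N\to W$. (The trivial $\Bbbk\mathbf G$-module is also denoted $\Bbbk_{\mathrm{tr}}$.) *)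

(* Defs.v *)
From HB Require Import structures.
From mathcomp Require Import all_boot all_algebra all_field.
From mathcomp Require Import ring_quotient.
From mathcomp.classical Require Import boolp.
From mathcomp Require Import finmap.
From mathcomp.multinomials Require Import monalg.
From mathcomp Require Import ring.

Set Implicit Arguments.
Unset Strict Implicit.
Unset Printing Implicit Defensive.

Import GRing.Theory.
Local Open Scope ring_scope.
Local Open Scope quotient_scope.

(* [malg_map f] : sum_x c_x x  |->  sum_x c_x f(x). *)
Section MalgMap.
Variables (X Y : choiceType) (R : nzRingType) (f : X -> Y).

Definition malg_map (a : {malg R[X]}) : {malg R[Y]} :=
  \sum_(x <- msupp a) << a@_x *g f x >>.

Lemma malg_mapEw (d : {fset X}) a : fsubset (msupp a) d ->
  malg_map a = \sum_(x <- d) << a@_x *g f x >>.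
Proof.
move=> le; rewrite /malg_map (big_fset_incl _ le) //= => x _ /mcoeff_outdom ->.
by rewrite monalgU0.
Qed.

Lemma malg_map_is_zmod_morphism : zmod_morphism malg_map.
Proof.
move=> a b; set d := fsetU (msupp a) (msupp b).
have [da db] : fsubset (msupp a) d /\ fsubset (msupp b) d.
  by rewrite fsubsetUl fsubsetUr.
rewrite (malg_mapEw da) (malg_mapEw db) (malg_mapEw (msuppB_le a b)).
by rewrite -sumrB; apply: eq_bigr => x _; rewrite mcoeffB monalgUB.
Qed.

HB.instance Definition _ :=
  GRing.isZmodMorphism.Build {malg R[X]} {malg R[Y]} malg_map
    malg_map_is_zmod_morphism.

Lemma malg_mapU c x : malg_map << c *g x >> = << c *g f x >>.
Proof. by rewrite (malg_mapEw msuppU_le) big_seq_fset1 mcoeffUU. Qed.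

End MalgMap.

Lemma malg_ind (X : choiceType) (A : zmodType) (P : {malg A[X]} -> Prop) :
  P 0 -> (forall a b, P a -> P b -> P (a + b)) ->
  (forall c x, P << c *g x >>) -> forall a, P a.
Proof. by move=> P0 PD PU a; rewrite [a]monalgE; apply: big_ind. Qed.

(* The group algebra R[G]: finitely supported functions G -> R under
   convolution.  [{malg R[G]}] only carries a ring structure for monoids
   without nontrivial units, hence the alias.  Modules over it are
   [lmodType (galg R G)]. *)
Definition galg (R : nzRingType) (G : groupType) : Type := {malg R[G]}.
HB.instance Definition _ R G := GRing.Lmodule.on (galg R G).

(* The basis element of R[G] given by g; locked for performance. *)
HB.lock Definition gelt (R : nzRingType) (G : groupType) (g : G) : galg R G :=
  << g >>.
Arguments gelt R {G} g.

Section GroupAlgebra.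
Variables (R : nzRingType) (G : groupType).
Implicit Types (a b : galg R G).

Definition galg_mul a b : galg R G :=
  \sum_(g <- msupp a) \sum_(h <- msupp b) << a@_g * b@_h *g (g * h)%g >>.

Lemma galg_mulEw (d1 d2 : {fset G}) a b :
  fsubset (msupp a) d1 -> fsubset (msupp b) d2 ->
  galg_mul a b = \sum_(g <- d1) \sum_(h <- d2) << a@_g * b@_h *g (g * h)%g >>.
Proof.
move=> le1 le2; rewrite /galg_mul (big_fset_incl _ le1) /=; last first.
  move=> g _ /mcoeff_outdom ag; rewrite big1 // => h _.
  by rewrite ag mul0r monalgU0.
apply: eq_bigr => g _; apply: big_fset_incl => // h _ /mcoeff_outdom ->.
by rewrite mulr0 monalgU0.
Qed.

Lemma galg_mulDl : left_distributive galg_mul +%R.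
Proof.
move=> a1 a2 b; set d := fsetU (msupp a1) (msupp a2).
have d1 : fsubset (msupp a1) d by rewrite fsubsetUl.
have d2 : fsubset (msupp a2) d by rewrite fsubsetUr.
have bb := fsubset_refl (msupp b).
rewrite (galg_mulEw d1 bb) (galg_mulEw d2 bb) (galg_mulEw (msuppD_le _ _) bb).
rewrite -big_split /=; apply: eq_bigr => g _.
rewrite -big_split /=; apply: eq_bigr => h _.
by rewrite mcoeffD mulrDl monalgUD.
Qed.

Lemma galg_mulDr : right_distributive galg_mul +%R.
Proof.
move=> a b1 b2; set d := fsetU (msupp b1) (msupp b2).
have d1 : fsubset (msupp b1) d by rewrite fsubsetUl.
have d2 : fsubset (msupp b2) d by rewrite fsubsetUr.
have aa := fsubset_refl (msupp a).
rewrite (galg_mulEw aa d1) (galg_mulEw aa d2) (galg_mulEw aa (msuppD_le _ _)).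
rewrite -big_split /=; apply: eq_bigr => g _.
rewrite -big_split /=; apply: eq_bigr => h _.
by rewrite mcoeffD mulrDr monalgUD.
Qed.

Lemma galg_mulUU c d (g h : G) :
  galg_mul << c *g g >> << d *g h >> = << c * d *g (g * h)%g >>.
Proof.
by rewrite (galg_mulEw msuppU_le msuppU_le) !big_seq_fset1 !mcoeffUU.
Qed.

Lemma galg_mul0r : left_zero 0 galg_mul.
Proof. by move=> a; rewrite /galg_mul msupp0 big_seq_fset0. Qed.

Lemma galg_mulr0 : right_zero 0 galg_mul.
Proof.
by move=> a; rewrite /galg_mul big1 // => g _; rewrite msupp0 big_seq_fset0.
Qed.

Lemma galg_mulA : associative galg_mul.
Proof.
move=> a b c; elim/malg_ind: a => [|a1 a2 IH1 IH2|x g].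
- by rewrite !galg_mul0r.
- by rewrite !galg_mulDl IH1 IH2.
elim/malg_ind: b => [|b1 b2 IH1 IH2|y h].
- by rewrite galg_mul0r galg_mulr0 galg_mul0r.
- by rewrite galg_mulDl !galg_mulDr IH1 IH2 galg_mulDl.
elim/malg_ind: c => [|c1 c2 IH1 IH2|z l].
- by rewrite !galg_mulr0.
- by rewrite !galg_mulDr IH1 IH2.
by rewrite !galg_mulUU mulrA mulgA.
Qed.

Lemma galg_mul1r : left_id (gelt R (1%g : G)) galg_mul.
Proof.
move=> a; elim/malg_ind: a => [|a1 a2 IH1 IH2|x g]; first by rewrite galg_mulr0.
  by rewrite galg_mulDr IH1 IH2.
by rewrite gelt.unlock galg_mulUU mul1r mul1g.
Qed.

Lemma galg_mulr1 : right_id (gelt R (1%g : G)) galg_mul.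
Proof.
move=> a; elim/malg_ind: a => [|a1 a2 IH1 IH2|x g]; first by rewrite galg_mul0r.
  by rewrite galg_mulDl IH1 IH2.
by rewrite gelt.unlock galg_mulUU mulr1 mulg1.
Qed.

Lemma galg_1neq0 : gelt R (1%g : G) != 0.
Proof. by rewrite gelt.unlock monalgU_eq0 oner_eq0. Qed.

HB.instance Definition _ := GRing.Zmodule_isNzRing.Build (galg R G)
  galg_mulA galg_mul1r galg_mulr1 galg_mulDl galg_mulDr galg_1neq0.

Lemma geltM (g h : G) : gelt R g * gelt R h = gelt R (g * h)%g.
Proof. by rewrite gelt.unlock [LHS]galg_mulUU mulr1. Qed.

End GroupAlgebra.

Lemma multiplicative1 (G H : groupType) (f : {multiplicative H -> G}) :
  f 1%g = 1%g.
Proof. by apply: (@mulgI _ (f 1%g)); rewrite -gmulfM !mulg1. Qed.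

Section GroupAlgebraMap.
Variables (R : nzRingType) (G H : groupType) (f : {multiplicative H -> G}).

Definition galg_map (a : galg R H) : galg R G := malg_map f a.

Lemma galg_map_is_zmod_morphism : zmod_morphism galg_map.
Proof. exact: malg_map_is_zmod_morphism. Qed.
HB.instance Definition _ :=
  GRing.isZmodMorphism.Build (galg R H) (galg R G) galg_map
    galg_map_is_zmod_morphism.

Lemma galg_map_gelt h : galg_map (gelt R h) = gelt R (f h).
Proof. by rewrite gelt.unlock; apply: malg_mapU. Qed.

Lemma galg_map_is_monoid_morphism : monoid_morphism galg_map.
Proof.
split=> [|a b].
  by rewrite -[1]/(gelt R 1%g) galg_map_gelt multiplicative1.
elim/malg_ind: a => [|a1 a2 IH1 IH2|x g]; first by rewrite mul0r !raddf0 mul0r.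
  by rewrite mulrDl !raddfD /= mulrDl IH1 IH2.
elim/malg_ind: b => [|b1 b2 IH1 IH2|y h]; first by rewrite mulr0 !raddf0 mulr0.
  by rewrite mulrDr !raddfD /= mulrDr IH1 IH2.
rewrite /galg_map [X in malg_map f X]galg_mulUU !malg_mapU.
by rewrite [RHS]galg_mulUU gmulfM.
Qed.
HB.instance Definition _ :=
  GRing.isMonoidMorphism.Build (galg R H) (galg R G) galg_map
    galg_map_is_monoid_morphism.

End GroupAlgebraMap.

(* The library does not derive closure under opposite from [submodClosed]. *)
Section SubmodPred.
Variables (R : nzRingType) (M : lmodType R) (X : submodClosed M).

Definition submod_pred : {pred M} := fun x => x \in X.

Lemma submod_pred_closed : submod_closed submod_pred.
Proof. exact: submodClosedP. Qed.
HB.instance Definition _ := GRing.isSubmodClosed.Build R M submod_pred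
  submod_pred_closed.

End SubmodPred.

Section Generated.
Variables (R : nzRingType) (M : lmodType R) (P : M -> Prop).

Definition gen_submod : {pred M} :=
  [pred x | `[< forall X : submodClosed M, (forall y, P y -> y \in X) -> x \in X >]].

Lemma gen_submod_closed : submod_closed gen_submod.
Proof.
split=> [|a x y /asboolP Px /asboolP Py]; apply/asboolP => X PX.
  exact: rpred0.
by rewrite rpredD ?rpredZ ?Px ?Py.
Qed.
HB.instance Definition _ := GRing.isSubmodClosed.Build R M gen_submod
  gen_submod_closed.

End Generated.

Section SubQuotient.
Variables (R : nzRingType) (M : lmodType R) (X : submodClosed M).

Definition sub_mod : Type := {x : M | x \in submod_pred X}.
HB.instance Definition _ := [Choice of sub_mod by <:].
HB.instance Definition _ := SubType.on sub_mod.
HB.instance Definition _ := [SubChoice_isSubLmodule of sub_mod by <:].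

Definition quot_mod : Type := Quotient.quot (submod_pred X).
HB.instance Definition _ := GRing.Zmodule.on quot_mod.

Definition quot_proj (x : M) : quot_mod := \pi_(Quotient.quot (submod_pred X)) x.

Definition quot_scale (a : R) (x : quot_mod) : quot_mod :=
  quot_proj (a *: repr (x : Quotient.quot (submod_pred X))).

Lemma quot_projP x y : (quot_proj x = quot_proj y) <-> (x - y \in X).
Proof.
split=> [|h].
  by move/eqP; rewrite /quot_proj -Quotient.idealrBE.
by apply/eqP; rewrite /quot_proj -Quotient.idealrBE.
Qed.

Lemma quot_proj_is_zmod_morphism : zmod_morphism quot_proj.
Proof. by move=> x y; rewrite /quot_proj raddfB. Qed.
HB.instance Definition _ := GRing.isZmodMorphism.Build M quot_mod quot_proj
  quot_proj_is_zmod_morphism.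

Lemma quot_proj_surj (x : quot_mod) : exists y, quot_proj y = x.
Proof. by exists (repr (x : Quotient.quot (submod_pred X))); rewrite /quot_proj reprK. Qed.

Lemma quot_scaleE a x : quot_scale a (quot_proj x) = quot_proj (a *: x).
Proof.
apply/quot_projP; rewrite -scalerBr rpredZ //; apply/quot_projP.
by rewrite /quot_proj reprK.
Qed.

Lemma quot_scaleA a b x : quot_scale a (quot_scale b x) = quot_scale (a * b) x.
Proof.
by have [y <-] := quot_proj_surj x; rewrite !quot_scaleE scalerA.
Qed.
Lemma quot_scale1 : left_id 1 quot_scale.
Proof.
by move=> x; have [y <-] := quot_proj_surj x; rewrite quot_scaleE scale1r.
Qed.
Lemma quot_scaleDr : right_distributive quot_scale +%R.
Proof.
move=> a x y; have [x' <-] := quot_proj_surj x.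
by have [y' <-] := quot_proj_surj y; rewrite -raddfD !quot_scaleE scalerDr raddfD.
Qed.
Lemma quot_scaleDl x : {morph quot_scale^~ x : a b / a + b}.
Proof.
move=> a b; have [y <-] := quot_proj_surj x.
by rewrite !quot_scaleE scalerDl raddfD.
Qed.

HB.instance Definition _ := GRing.Zmodule_isLmodule.Build R quot_mod
  quot_scaleA quot_scale1 quot_scaleDr quot_scaleDl.

Lemma quot_proj_is_scalable : scalable quot_proj.
Proof. by move=> a x; rewrite -quot_scaleE. Qed.
HB.instance Definition _ := GRing.isScalable.Build R M quot_mod *:%R quot_proj
  quot_proj_is_scalable.

End SubQuotient.

Definition mod_iso (R : nzRingType) (M N : lmodType R) : Prop :=
  exists f : {linear M -> N}, bijective f.

Definition simple_mod (R : nzRingType) (M : lmodType R) : Prop :=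
  (exists x : M, x != 0) /\
  forall X : submodClosed M, X =i pred1 0 \/ X =i predT.

Definition maximal_submod (R : nzRingType) (M : lmodType R) (X : submodClosed M) :
    Prop :=
  (exists x, x \notin X) /\
  forall Y : submodClosed M, {subset X <= Y} -> Y =i X \/ Y =i predT.

Lemma simple_quotP (R : nzRingType) (M : lmodType R) (X : submodClosed M) :
  simple_mod (quot_mod X) <-> maximal_submod X.
Proof.
have projE x : (quot_proj X x == 0) = (x \in X).
  rewrite -(raddf0 (quot_proj X)); apply/eqP/idP => [/quot_projP|h].
    by rewrite subr0.
  by apply/quot_projP; rewrite subr0.
split=> [[[t t0] simp]|[[x xX] maxX]].
  have [x xt] := quot_proj_surj t; split.
    by exists x; rewrite -projE xt.
  move=> Y XY; pose Z : {pred quot_mod X} := [pred u | `[< exists2 y, y \in Y & quot_proj X y = u >]].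
  have Zc : submod_closed Z.
    split=> [|a u v /asboolP[y yY <-] /asboolP[z zY <-]]; apply/asboolP.
      by exists 0; [exact: rpred0 | exact: raddf0].
    by exists (a *: y + z); [rewrite rpredD ?rpredZ | rewrite linearP].
  pose ZI := GRing.isSubmodClosed.Build R (quot_mod X) Z Zc.
  pose ZZ : submodClosed (quot_mod X) := HB.pack Z ZI.
  have [Z0|ZT] := simp ZZ; [left|right] => y; apply/idP/idP => //.
  - move=> yY; rewrite -projE; have := Z0 (quot_proj X y); rewrite !inE => <-.
    by apply/asboolP; exists y.
  - exact: XY.
  have /asboolP[z zY /quot_projP zy] : quot_proj X y \in ZZ by rewrite ZT.
  by rewrite -[y](subKr z) rpredD // -scaleN1r rpredZ // XY.
split; first by exists (quot_proj X x); rewrite projE.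
move=> Z; pose Y : {pred M} := [pred y | quot_proj X y \in Z].
have Yc : submod_closed Y.
  split=> [|a u v]; rewrite !inE ?raddf0 ?rpred0 // => uZ vZ.
  by rewrite linearP rpredD ?rpredZ.
pose YI := GRing.isSubmodClosed.Build R M Y Yc.
pose YY : submodClosed M := HB.pack Y YI.
have XY : {subset X <= YY}.
  by move=> y; rewrite -projE => /eqP yX; rewrite -[_ \in _]/(quot_proj X y \in Z) yX rpred0.
have [YX|YT] := maxX YY XY; [left|right] => u.
  by have [y <-] := quot_proj_surj u; rewrite inE projE -YX.
by have [y <-] := quot_proj_surj u; have := YT y.
Qed.

(* S (x)_R V, with S a right R-module through f : R -> S: the free abelian
   group on S x V modulo the biadditivity and balancing relations. *)
Section Tensor.
Variables (R S : nzRingType) (f : {rmorphism R -> S}) (V : lmodType R).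

Local Notation free := {malg int[(S * V)%type]}.

Variant tensor_rel : free -> Prop :=
| TensorDl x y v :
    tensor_rel (<< ((x + y, v) : S * V) >> - << (x, v) >> - << (y, v) >>)
| TensorDr x v w :
    tensor_rel (<< ((x, v + w) : S * V) >> - << (x, v) >> - << (x, w) >>)
| TensorM x r v :
    tensor_rel (<< ((x * f r, v) : S * V) >> - << (x, r *: v) >>).

Definition tensor_ker : {pred free} :=
  [pred z | `[< forall I : zmodClosed free,
                  (forall y, tensor_rel y -> y \in I) -> z \in I >]].

Lemma tensor_ker_closed : zmod_closed tensor_ker.
Proof.
split=> [|x y /asboolP Px /asboolP Py]; apply/asboolP => I PI.
  exact: rpred0.
by rewrite rpredB ?Px ?Py.
Qed.
HB.instance Definition _ := GRing.isZmodClosed.Build free tensor_ker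
  tensor_ker_closed.

Definition tensor : Type := Quotient.quot tensor_ker.
HB.instance Definition _ := GRing.Zmodule.on tensor.

Definition tensor_pi (z : free) : tensor := \pi_(Quotient.quot tensor_ker) z.

Definition tens (x : S) (v : V) : tensor := tensor_pi << (x, v) >>.

Lemma tensor_pi_is_zmod_morphism : zmod_morphism tensor_pi.
Proof. by move=> x y; rewrite /tensor_pi raddfB. Qed.
HB.instance Definition _ := GRing.isZmodMorphism.Build free tensor tensor_pi
  tensor_pi_is_zmod_morphism.

Lemma tensor_piP x y : (tensor_pi x = tensor_pi y) <-> (x - y \in tensor_ker).
Proof.
split=> [|h].
  by move/eqP; rewrite /tensor_pi -Quotient.idealrBE.
by apply/eqP; rewrite /tensor_pi -Quotient.idealrBE.
Qed.

Lemma tensor_relP z : tensor_rel z -> tensor_pi z = 0.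
Proof.
move=> zP; rewrite -(raddf0 tensor_pi); apply/tensor_piP; rewrite subr0.
by apply/asboolP => I; apply.
Qed.

Lemma tensDl x y v : tens (x + y) v = tens x v + tens y v.
Proof.
apply/eqP; rewrite -subr_eq0 opprD addrA -!raddfB; apply/eqP.
exact/tensor_relP/TensorDl.
Qed.

Lemma tensDr x v w : tens x (v + w) = tens x v + tens x w.
Proof.
apply/eqP; rewrite -subr_eq0 opprD addrA -!raddfB; apply/eqP.
exact/tensor_relP/TensorDr.
Qed.

Lemma tensM x r v : tens (x * f r) v = tens x (r *: v).
Proof.
by apply/eqP; rewrite -subr_eq0 -!raddfB; apply/eqP/tensor_relP/TensorM.
Qed.

Definition tensor_lact (a : S) (z : free) : free :=
  malg_map (fun p : S * V => (a * p.1, p.2)) z.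

Lemma tensor_lact_is_zmod_morphism a : zmod_morphism (tensor_lact a).
Proof. exact: malg_map_is_zmod_morphism. Qed.
HB.instance Definition _ a := GRing.isZmodMorphism.Build free free (tensor_lact a)
  (tensor_lact_is_zmod_morphism a).

Lemma tensor_lactU a c x v :
  tensor_lact a << c *g ((x, v) : S * V) >> = << c *g (a * x, v) >>.
Proof. exact: malg_mapU. Qed.

Lemma tensor_lact_ker a z : z \in tensor_ker -> tensor_lact a z \in tensor_ker.
Proof.
move=> /asboolP zP; apply/asboolP => I PI.
pose J : {pred free} := [pred y | tensor_lact a y \in I].
have Jclosed : zmod_closed J.
  by split=> [|x y]; rewrite !inE ?raddf0 ?rpred0 // raddfB; apply: rpredB.
pose JI := GRing.isZmodClosed.Build free J Jclosed.
pose JZ : zmodClosed free := HB.pack J JI.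
apply: (zP JZ) => y [x x' v|x v w|x r v]; rewrite -[_ \in _]/(tensor_lact a _ \in I) !raddfB /= !tensor_lactU.
- by rewrite mulrDr; apply/PI/TensorDl.
- exact/PI/TensorDr.
by rewrite mulrA; apply/PI/TensorM.
Qed.

Definition tensor_scale (a : S) (t : tensor) : tensor :=
  tensor_pi (tensor_lact a (repr (t : Quotient.quot tensor_ker))).

Lemma tensor_pi_surj (t : tensor) : exists z, tensor_pi z = t.
Proof. by exists (repr (t : Quotient.quot tensor_ker)); rewrite /tensor_pi reprK. Qed.

Lemma tensor_scaleE a z : tensor_scale a (tensor_pi z) = tensor_pi (tensor_lact a z).
Proof.
apply/tensor_piP; rewrite -raddfB tensor_lact_ker //; apply/tensor_piP.
by rewrite /tensor_pi reprK.
Qed.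

Lemma tensor_ind (P : tensor -> Prop) :
  P 0 -> (forall t u, P t -> P u -> P (t + u)) -> (forall t, P t -> P (- t)) ->
  (forall x v, P (tens x v)) -> forall t, P t.
Proof.
move=> P0 PD PN PU t; have [z <-] := tensor_pi_surj t.
elim/malg_ind: z => [|a b IHa IHb|c [x v]]; first by rewrite raddf0.
  by rewrite raddfD; apply: PD.
have Pn n : P (tens x v *+ n).
  by elim: n => [|n IHn]; rewrite ?mulr0n // mulrS; apply: PD.
have -> : tensor_pi << c *g (x, v) >> = tens x v *~ c.
  rewrite /tens -raddfMz; congr tensor_pi; apply/malgP => p.
  by rewrite raddfMz /= !mcoeffU; case: eqP; rewrite ?mulr0n ?mul0rz // !mulr1n intz.
by case: c => n; [exact: Pn | rewrite NegzE mulrNz; apply/PN/Pn].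
Qed.

Lemma tensor_scaleU a x v : tensor_scale a (tens x v) = tens (a * x) v.
Proof. by rewrite /tens tensor_scaleE tensor_lactU. Qed.

Lemma tensor_scaleDr : right_distributive tensor_scale +%R.
Proof.
move=> a t u; have [y <-] := tensor_pi_surj t; have [z <-] := tensor_pi_surj u.
by rewrite -raddfD !tensor_scaleE !raddfD.
Qed.

Lemma tensor_scale0 a : tensor_scale a 0 = 0.
Proof. by apply: (addrI (tensor_scale a 0)); rewrite -tensor_scaleDr !addr0. Qed.

Lemma tensor_scaleN a t : tensor_scale a (- t) = - tensor_scale a t.
Proof.
by apply: (addrI (tensor_scale a t)); rewrite -tensor_scaleDr !subrr tensor_scale0.
Qed.

Lemma tensor_scaleA a b t :
  tensor_scale a (tensor_scale b t) = tensor_scale (a * b) t.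
Proof.
elim/tensor_ind: t => [|t u IHt IHu|t IHt|x v].
- by rewrite !tensor_scale0.
- by rewrite !tensor_scaleDr IHt IHu.
- by rewrite !tensor_scaleN IHt.
by rewrite !tensor_scaleU mulrA.
Qed.

Lemma tensor_scale1 : left_id 1 tensor_scale.
Proof.
elim/tensor_ind => [|t u IHt IHu|t IHt|x v].
- by rewrite tensor_scale0.
- by rewrite tensor_scaleDr IHt IHu.
- by rewrite tensor_scaleN IHt.
by rewrite tensor_scaleU mul1r.
Qed.

Lemma tensor_scaleDl t : {morph tensor_scale^~ t : a b / a + b}.
Proof.
move=> a b; elim/tensor_ind: t => [|t u IHt IHu|t IHt|x v].
- by rewrite !tensor_scale0 addr0.
- by rewrite !tensor_scaleDr IHt IHu addrACA.
- by rewrite !tensor_scaleN IHt opprD.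
by rewrite !tensor_scaleU mulrDl tensDl.
Qed.

HB.instance Definition _ := GRing.Zmodule_isLmodule.Build S tensor
  tensor_scaleA tensor_scale1 tensor_scaleDr tensor_scaleDl.

Lemma tensor_scale_tens a x v : a *: tens x v = tens (a * x) v.
Proof. exact: tensor_scaleU. Qed.

Lemma tensor_universal (W : lmodType S) (g : {additive V -> W}) :
  (forall r v, g (r *: v) = f r *: g v) ->
  exists h : {linear tensor -> W}, forall x v, h (tens x v) = x *: g v.
Proof.
move=> gZ; pose q (p : S * V) : W := p.1 *: g p.2.
pose e (z : free) : W := \sum_(p <- msupp z) q p *~ z@_p.
have eEw (d : {fset (S * V)}) z : fsubset (msupp z) d -> e z = \sum_(p <- d) q p *~ z@_p.
  move=> le; rewrite /e (big_fset_incl _ le) //= => p _ /mcoeff_outdom ->.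
  by rewrite mulr0z.
have eB : zmod_morphism e.
  move=> a b; set d := fsetU (msupp a) (msupp b).
  have [da db] : fsubset (msupp a) d /\ fsubset (msupp b) d.
    by rewrite fsubsetUl fsubsetUr.
  rewrite (eEw _ _ da) (eEw _ _ db) (eEw _ _ (msuppB_le a b)) -sumrB.
  by apply: eq_bigr => p _; rewrite mcoeffB mulrzBr.
have e0 : e 0 = 0 by rewrite /e msupp0 big_seq_fset0.
have eU x v : e << (x, v) >> = x *: g v.
  by rewrite (eEw _ _ msuppU_le) big_seq_fset1 mcoeffUU.
pose J : {pred free} := [pred y | e y == 0].
have Jclosed : zmod_closed J.
  by split=> [|x y]; rewrite !inE ?e0 // eB => /eqP -> /eqP ->; rewrite subr0.
pose JI := GRing.isZmodClosed.Build free J Jclosed.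
pose JZ : zmodClosed free := HB.pack J JI.
have eker z : z \in tensor_ker -> e z = 0.
  move=> /asboolP /(_ JZ) zJ; apply/eqP/zJ => y [x x' v|x v w|x r v];
    rewrite -[_ \in _]/(e _ == 0) !eB !eU.
  - by rewrite scalerDl addrAC addrK subrr.
  - by rewrite raddfD scalerDr addrAC addrK subrr.
  by rewrite gZ scalerA subrr.
pose h (t : tensor) : W := e (repr (t : Quotient.quot tensor_ker)).
have hE z : h (tensor_pi z) = e z.
  apply/eqP; rewrite -subr_eq0 -eB; apply/eqP/eker; apply/tensor_piP.
  by rewrite /tensor_pi reprK.
have hB : zmod_morphism h.
  move=> t u; have [y <-] := tensor_pi_surj t; have [z <-] := tensor_pi_surj u.
  by rewrite -raddfB !hE eB.
have h0 : h 0 = 0 by rewrite -[0 in LHS](subrr 0) hB subrr.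
have hN t : h (- t) = - h t by rewrite -sub0r hB h0 sub0r.
have hD t u : h (t + u) = h t + h u by rewrite -[u in LHS]opprK hB hN opprK.
have hZ : scalable h.
  move=> a; elim/tensor_ind => [|t u IHt IHu|t IHt|x v].
  - by rewrite scaler0 h0 scaler0.
  - by rewrite scalerDr !hD IHt IHu scalerDr.
  - by rewrite scalerN !hN IHt scalerN.
  by rewrite tensor_scale_tens !hE !eU scalerA.
pose hA := GRing.isZmodMorphism.Build tensor W h hB.
pose hS := GRing.isScalable.Build S tensor W *:%R h hZ.
pose hL : {linear tensor -> W} := HB.pack h hA hS.
by exists hL => x v; rewrite -[LHS]/(h (tens x v)) hE eU.
Qed.
End Tensor.

(* Ind_H^K V = R[K] (x)_{R[H]} V for a subgroup H of K. *)
Section Induced.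
Variables (R : nzRingType) (K : groupType) (P : pred K) (H : subGroupType P).
Variable V : lmodType (galg R H).

Definition Ind : lmodType (galg R K) := tensor (@galg_map R K H val) V.

Definition ind_tens (a : galg R K) (v : V) : Ind :=
  tens (@galg_map R K H val) a v.

Lemma ind_tens_scale a b v : a *: ind_tens b v = ind_tens (a * b) v.
Proof. exact: tensor_scale_tens. Qed.

Lemma ind_tens_gelt a (h : H) v :
  ind_tens (a * gelt R (val h)) v = ind_tens a (gelt R h *: v).
Proof. by rewrite /ind_tens -tensM /= galg_map_gelt. Qed.

End Induced.

(* The multiplicative group k^*.  A group homomorphism H -> k^* is a
   [{multiplicative H -> Gm k}]; preservation of 1 and inverses follows. *)
Section UnitGroup.
Variable k : fieldType.

Definition Gm : Type := {x : k | x != 0}.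
HB.instance Definition _ := SubType.on Gm.
HB.instance Definition _ := [Choice of Gm by <:].

Definition Gm_one : Gm := Sub 1 (oner_neq0 k).
Definition Gm_mul (x y : Gm) : Gm := Sub (val x * val y) (mulf_neq0 (valP x) (valP y)).
Definition Gm_inv (x : Gm) : Gm := Sub (val x)^-1 (invr_neq0 (valP x)).

Lemma Gm_mulA : associative Gm_mul.
Proof. by move=> x y z; apply: val_inj; rewrite /= mulrA. Qed.
Lemma Gm_mul1 : left_id Gm_one Gm_mul.
Proof. by move=> x; apply: val_inj; rewrite /= mul1r. Qed.
Lemma Gm_mulr1 : right_id Gm_one Gm_mul.
Proof. by move=> x; apply: val_inj; rewrite /= mulr1. Qed.
Lemma Gm_mulV : left_inverse Gm_one Gm_inv Gm_mul.
Proof. by move=> x; apply: val_inj; rewrite /= mulVf ?(valP x). Qed.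
Lemma Gm_mulrV : right_inverse Gm_one Gm_inv Gm_mul.
Proof. by move=> x; apply: val_inj; rewrite /= mulfV ?(valP x). Qed.

HB.instance Definition _ := isGroup.Build Gm
  Gm_mulA Gm_mul1 Gm_mulr1 Gm_mulV Gm_mulrV.

End UnitGroup.

(* The one-dimensional module k_theta: a copy of k on which h acts as theta(h). *)
Definition char_mod (k : fieldType) (H : groupType)
  (theta : {multiplicative H -> Gm k}) : Type := k.

Section CharacterModule.
Variables (k : fieldType) (H : groupType) (theta : {multiplicative H -> Gm k}).
Local Notation char_mod := (char_mod theta).

Definition char_ev (a : galg k H) : k :=
  \sum_(h <- msupp a) a@_h * val (theta h).

Lemma char_evEw (d : {fset H}) (a : galg k H) : fsubset (msupp a) d ->
  char_ev a = \sum_(h <- d) a@_h * val (theta h).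
Proof.
move=> le; rewrite /char_ev (big_fset_incl _ le) //= => h _ /mcoeff_outdom ->.
by rewrite mul0r.
Qed.

Lemma char_evU c h : char_ev << c *g h >> = c * val (theta h).
Proof. by rewrite (char_evEw msuppU_le) big_seq_fset1 mcoeffUU. Qed.

Lemma char_ev_is_zmod_morphism : zmod_morphism char_ev.
Proof.
move=> a b; set d := fsetU (msupp a) (msupp b).
have [da db] : fsubset (msupp a) d /\ fsubset (msupp b) d.
  by rewrite fsubsetUl fsubsetUr.
rewrite (char_evEw da) (char_evEw db) (char_evEw (msuppB_le a b)) -sumrB.
by apply: eq_bigr => h _; rewrite mcoeffB mulrBl.
Qed.
HB.instance Definition _ := GRing.isZmodMorphism.Build (galg k H) k char_ev
  char_ev_is_zmod_morphism.

Lemma char_ev_is_monoid_morphism : monoid_morphism char_ev.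
Proof.
split=> [|a b].
  by rewrite -[1]/(gelt k 1%g) gelt.unlock char_evU multiplicative1 /= mulr1.
elim/malg_ind: a => [|a1 a2 IH1 IH2|x g]; first by rewrite mul0r !raddf0 mul0r.
  by rewrite mulrDl !raddfD /= mulrDl IH1 IH2.
elim/malg_ind: b => [|b1 b2 IH1 IH2|y h]; first by rewrite mulr0 !raddf0 mulr0.
  by rewrite mulrDr !raddfD /= mulrDr IH1 IH2.
by rewrite [X in char_ev X]galg_mulUU !char_evU gmulfM /= mulrACA.
Qed.
HB.instance Definition _ := GRing.isMonoidMorphism.Build (galg k H) k char_ev
  char_ev_is_monoid_morphism.

HB.instance Definition _ := GRing.Zmodule.on char_mod.

Definition char_scale (a : galg k H) (v : char_mod) : char_mod :=
  char_ev a * (v : k).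

Lemma char_scaleA a b v : char_scale a (char_scale b v) = char_scale (a * b) v.
Proof. by rewrite /char_scale mulrA rmorphM. Qed.
Lemma char_scale1 : left_id 1 char_scale.
Proof. by move=> v; rewrite /char_scale rmorph1 mul1r. Qed.
Lemma char_scaleDr : right_distributive char_scale +%R.
Proof. by move=> a u v; rewrite /char_scale mulrDr. Qed.
Lemma char_scaleDl v : {morph char_scale^~ v : a b / a + b}.
Proof. by move=> a b; rewrite /char_scale rmorphD mulrDl. Qed.

HB.instance Definition _ := GRing.Zmodule_isLmodule.Build (galg k H) char_mod
  char_scaleA char_scale1 char_scaleDr char_scaleDl.

Lemma gelt_scaleE (h : H) (v : char_mod) : gelt k h *: v = val (theta h) * (v : k).
Proof. by rewrite -[LHS]/(char_ev _ * (v : k)) gelt.unlock char_evU mul1r. Qed.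

End CharacterModule.

Definition triv_char (k : fieldType) (H : groupType) : {multiplicative H -> Gm k} :=
  @one_fun H (Gm k).

Lemma ord2P (i : 'I_2) : {i = 0} + {i = 1}.
Proof. by case: i => [[|[|//]] h]; [left|right]; apply: val_inj. Qed.

Lemma sum_ord2 (V : nmodType) (f : 'I_2 -> V) : \sum_i f i = f 0 + f 1.
Proof. by rewrite big_ord_recl big_ord1; congr (f _ + f _); apply: val_inj. Qed.

Lemma det_mx2E (R : comNzRingType) (A : 'M[R]_2) :
  \det A = A 0 0 * A 1 1 - A 0 1 * A 1 0.
Proof.
rewrite (expand_det_row _ 0) sum_ord2 /cofactor !det_mx11 !mxE /=.
rewrite expr0 expr1 mul1r mulN1r mulrN; congr (_ * A _ _ - _ * A _ _).
all: exact: val_inj.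
Qed.

(* Locked: unification should not compare matrices by evaluation. *)
HB.lock Definition mx2 (R : nzRingType) (a b c d : R) : 'M[R]_2 :=
  \matrix_(i, j) (if i == 0 then if j == 0 then a else b
                  else if j == 0 then c else d).

Lemma mx2E (R : nzRingType) (a b c d : R) :
  ((mx2 a b c d 0 0 = a) * (mx2 a b c d 0 1 = b) *
   (mx2 a b c d 1 0 = c) * (mx2 a b c d 1 1 = d))%type.
Proof. by rewrite mx2.unlock !mxE. Qed.

Section SL2.
Variable F : fieldType.

Definition SL2 : Type := {A : 'M[F]_2 | \det A == 1}.
HB.instance Definition _ := SubType.on SL2.
HB.instance Definition _ := [Choice of SL2 by <:].

Lemma SL2_unit (A : SL2) : val A \in unitmx.
Proof. by rewrite unitmxE (eqP (valP A)) unitr1. Qed.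

Lemma SL2_det1 : \det (1%:M : 'M[F]_2) == 1.
Proof. by rewrite det1. Qed.
Lemma SL2_detM (A B : SL2) : \det (val A *m val B) == 1.
Proof. by rewrite det_mulmx (eqP (valP A)) (eqP (valP B)) mulr1. Qed.
Lemma SL2_detV (A : SL2) : \det (invmx (val A)) == 1.
Proof. by rewrite det_inv (eqP (valP A)) invr1. Qed.

Definition SL2_one : SL2 := Sub 1%:M SL2_det1.
Definition SL2_mul (A B : SL2) : SL2 := Sub (val A *m val B) (SL2_detM A B).
Definition SL2_inv (A : SL2) : SL2 := Sub (invmx (val A)) (SL2_detV A).

Lemma SL2_mulA : associative SL2_mul.
Proof. by move=> A B C; apply: val_inj; rewrite /= mulmxA. Qed.
Lemma SL2_mul1 : left_id SL2_one SL2_mul.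
Proof. by move=> A; apply: val_inj; rewrite /= mul1mx. Qed.
Lemma SL2_mulr1 : right_id SL2_one SL2_mul.
Proof. by move=> A; apply: val_inj; rewrite /= mulmx1. Qed.
Lemma SL2_mulV : left_inverse SL2_one SL2_inv SL2_mul.
Proof. by move=> A; apply: val_inj; rewrite /= mulVmx ?SL2_unit. Qed.
Lemma SL2_mulrV : right_inverse SL2_one SL2_inv SL2_mul.
Proof. by move=> A; apply: val_inj; rewrite /= mulmxV ?SL2_unit. Qed.

HB.instance Definition _ := isGroup.Build SL2
  SL2_mulA SL2_mul1 SL2_mulr1 SL2_mulV SL2_mulrV.

Lemma SL2P (A B : SL2) :
  val A 0 0 = val B 0 0 -> val A 0 1 = val B 0 1 ->
  val A 1 0 = val B 1 0 -> val A 1 1 = val B 1 1 -> A = B.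
Proof.
move=> e00 e01 e10 e11; apply/val_inj/matrixP => i j.
by case: (ord2P i) => ->; case: (ord2P j) => ->.
Qed.

Lemma SL2_mulE (A B : SL2) i j :
  val (A * B)%g i j = val A i 0 * val B 0 j + val A i 1 * val B 1 j.
Proof. by rewrite mxE sum_ord2. Qed.

Lemma SL2_detE (A : SL2) :
  val A 0 0 * val A 1 1 - val A 0 1 * val A 1 0 = 1.
Proof. by rewrite -det_mx2E (eqP (valP A)). Qed.

Lemma mx2_det (a b c d : F) : a * d - b * c = 1 -> \det (mx2 a b c d) == 1.
Proof. by move=> h; rewrite det_mx2E !mx2E h. Qed.

Lemma SL2_invE (A : SL2) :
  val A^-1%g = mx2 (val A 1 1) (- val A 0 1) (- val A 1 0) (val A 0 0).
Proof.
set B := mx2 _ _ _ _.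
have detB : \det B == 1.
  by apply: mx2_det; rewrite mulrNN mulrC; apply: SL2_detE.
suff -> : A^-1%g = Sub B detB by [].
apply: (@mulgI _ A); rewrite mulgV; apply: SL2P; rewrite SL2_mulE /= !mx2E !mxE /=.
- by rewrite mulrN SL2_detE.
- by rewrite mulrN mulrC addNr.
- by rewrite mulrN [X in _ - X]mulrC subrr.
by rewrite mulrN addrC mulrC [X in _ - X]mulrC SL2_detE.
Qed.

Lemma sdot_det : \det (mx2 0 1 (-1) 0 : 'M[F]_2) == 1.
Proof. by apply: mx2_det; rewrite mul0r mul1r opprK add0r. Qed.

Definition sdot : SL2 := Sub (mx2 0 1 (-1) 0) sdot_det.

Definition torus : {pred SL2} := fun A => is_diag_mx (val A).

Definition borel : {pred SL2} := fun A => val A 1 0 == 0.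

Lemma torusP (A : SL2) :
  reflect (val A 0 1 = 0 /\ val A 1 0 = 0) (A \in torus).
Proof.
apply: (iffP is_diag_mxP) => [h|[h01 h10] i j]; first by split; apply: h.
by case: (ord2P i) => ->; case: (ord2P j) => ->; rewrite ?eqxx.
Qed.

Lemma torus_group_closed : group_closed torus.
Proof.
split=> [|A B /torusP[a01 a10] /torusP[b01 b10]].
  by apply/torusP; rewrite !mxE.
apply/torusP; rewrite !SL2_mulE !SL2_invE !mx2E.
by rewrite a01 a10 b01 b10 !oppr0 !mulr0 !mul0r !addr0.
Qed.

Lemma borelE (A : SL2) : (A \in borel) = (val A 1 0 == 0).
Proof. by []. Qed.

Lemma borel_group_closed : group_closed borel.
Proof.
split=> [|A B /eqP a10 /eqP b10]; first by rewrite borelE !mxE.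
by rewrite borelE SL2_mulE SL2_invE !mx2E a10 b10 oppr0 mulr0 mul0r addr0.
Qed.

Definition torus_group : Type := {A : SL2 | A \in torus}.
HB.instance Definition _ := SubType.on torus_group.
HB.instance Definition _ := [Choice of torus_group by <:].
HB.instance Definition _ :=
  SubChoice_isSubGroup.Build SL2 torus torus_group torus_group_closed.

Definition borel_group : Type := {A : SL2 | A \in borel}.
HB.instance Definition _ := SubType.on borel_group.
HB.instance Definition _ := [Choice of borel_group by <:].
HB.instance Definition _ :=
  SubChoice_isSubGroup.Build SL2 borel borel_group borel_group_closed.

(* The projection B -> T with kernel the unipotent radical. *)
Lemma borel_diag_det (b : borel_group) :
  \det (mx2 (val (val b) 0 0) 0 0 (val (val b) 1 1)) == 1.
Proof.
apply: mx2_det; rewrite mulr0 subr0 -[RHS](SL2_detE (val b)).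
by rewrite (eqP (valP b)) mulr0 subr0.
Qed.

Definition borel_diag (b : borel_group) : SL2 :=
  Sub (mx2 (val (val b) 0 0) 0 0 (val (val b) 1 1)) (borel_diag_det b).

Lemma borel_diagP b : borel_diag b \in torus.
Proof. by apply/torusP; rewrite /= !mx2E. Qed.

Definition borel_proj (b : borel_group) : torus_group :=
  Sub (borel_diag b) (borel_diagP b).

Lemma borel_projM : {morph borel_proj : x y / (x * y)%g}.
Proof.
move=> x y; apply: val_inj; apply: SL2P; rewrite SL2_mulE /= !mx2E ?mxE ?sum_ord2.
all: rewrite ?(eqP (valP x)) ?(eqP (valP y)).
all: by rewrite ?mulr0 ?mul0r ?addr0 ?add0r.
Qed.
HB.instance Definition _ :=
  monoid.isMultiplicative.Build borel_group torus_group borel_proj borel_projM.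

(* t |-> sdot^-1 t sdot; mathcomp's [x ^ y] is y^-1 * x * y. *)
Lemma torus_conj (t : SL2) : t \in torus -> (t ^ sdot)%g \in torus.
Proof.
move=> /torusP[t01 t10]; apply/torusP.
rewrite /conjg !SL2_mulE !SL2_invE !mx2E t01 t10.
by rewrite ?(mulr0, mul0r, addr0, add0r, mulr1, mul1r, oppr0).
Qed.

Definition torus_s (t : torus_group) : torus_group :=
  Sub (val t ^ sdot)%g (torus_conj (valP t)).

Lemma torus_sM : {morph torus_s : x y / (x * y)%g}.
Proof. by move=> x y; apply: val_inj; rewrite /= conjMg. Qed.
HB.instance Definition _ :=
  monoid.isMultiplicative.Build torus_group torus_group torus_s torus_sM.

End SL2.

(* {x | x^-1 S x = S} *)
Definition normalizer (G : groupType) (S : {pred G}) : {pred G} :=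
  fun x => `[< forall y, ((y ^ x)%g \in S) = (y \in S) >].

Lemma normalizer_group_closed (G : groupType) (S : {pred G}) :
  group_closed (normalizer S).
Proof.
split=> [|x y /asboolP Sx /asboolP Sy]; apply/asboolP => z.
  by rewrite conjg1.
by rewrite -[LHS]Sy -conjgM -mulgA mulVg mulg1 Sx.
Qed.

Section NormalizerTorus.
Variable F : closedFieldType.
Notation SL2 := (SL2 F).
Notation N := (normalizer (@torus F)).

Definition ntorus_group : Type := {A : SL2 | A \in N}.
HB.instance Definition _ := SubType.on ntorus_group.
HB.instance Definition _ := [Choice of ntorus_group by <:].
HB.instance Definition _ :=
  SubChoice_isSubGroup.Build SL2 N ntorus_group (normalizer_group_closed _).

Lemma torus_regular : exists a : F, a != 0 /\ a != a^-1.
Proof.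
pose P (i : nat) : F := if i == 2%N then 0 else 1.
have [a] := @solve_monicpoly F 3 P isT.
rewrite !big_ord_recl big_ord0 /P /= mul0r !mul1r expr0 expr1 !addr0 => ha.
have a0 : a != 0.
  by apply/eqP=> a0; move/eqP: ha; rewrite a0 expr0n addr0 eq_sym oner_eq0.
exists a; split=> //; apply/eqP => aV.
have a2 : a ^+ 2 = 1 by rewrite expr2 {2}aV mulfV.
move/eqP: ha; rewrite exprS a2 mulr1 -subr_eq0 opprD addrCA subrr addr0 oppr_eq0.
by rewrite oner_eq0.
Qed.

Lemma mx2_diag_det (a : F) : a != 0 -> \det (mx2 a 0 0 a^-1) == 1.
Proof. by move=> a0; apply: mx2_det; rewrite mulfV // mulr0 subr0. Qed.

Lemma ntorusP (x : SL2) : x \in N ->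
  x \notin @torus F -> val x 0 0 = 0 /\ val x 1 1 = 0.
Proof.
move=> /asboolP xN xT; have [a [a0 aV]] := torus_regular.
pose t : SL2 := Sub (mx2 a 0 0 a^-1) (mx2_diag_det a0).
have: (t ^ x)%g \in @torus F by rewrite xN; apply/torusP; rewrite /= !mx2E.
move=> /torusP[]; rewrite /conjg !SL2_mulE !SL2_invE !mx2E.
set b := val x 0 0; set c := val x 0 1; set d := val x 1 0; set e := val x 1 1.
rewrite !(mulr0, mul0r, addr0, add0r) => h1 h2.
have aN : a - a^-1 != 0 by rewrite subr_eq0.
have ce : c * e = 0.
  by apply: (mulfI aN); rewrite mulr0 -[RHS]h1; ring.
have db : d * b = 0.
  by apply: (mulfI aN); rewrite mulr0 -[RHS]oppr0 -h2; ring.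
have det : b * e - c * d = 1 by exact: SL2_detE.
have [c0|c0] := eqVneq c 0.
  have d0 : d = 0.
    have b0 : b != 0.
      apply/eqP => b0; move/eqP: det; rewrite b0 c0 !mul0r subrr eq_sym.
      by rewrite oner_eq0.
    by apply: (mulIf b0); rewrite db mul0r.
  by case/negP: xT; apply/torusP.
have e0 : e = 0 by apply: (mulfI c0); rewrite ce mulr0.
split=> //.
have d0 : d != 0.
  apply/eqP => d0; move/eqP: det; rewrite d0 e0 !mulr0 subrr eq_sym.
  by rewrite oner_eq0.
by apply: (mulfI d0); rewrite db mulr0.
Qed.

Lemma sdot_normalizes : sdot F \in N.
Proof.
apply/asboolP => y; apply/idP/idP => [h|]; last exact: torus_conj.
have -> : y = ((y ^ sdot F) ^ (sdot F)^-1)%g by rewrite -conjgM mulgV conjg1.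
move/torusP: h => []; rewrite [val (y ^ _)%g]lock => t01 t10; apply/torusP.
move: (y ^ _)%g t01 t10 => t; rewrite -lock => t01 t10.
rewrite /conjg invgK !SL2_mulE !SL2_invE !mx2E t01 t10.
by rewrite ?(mulr0, mul0r, addr0, add0r, mulr1, mul1r, oppr0).
Qed.

Variable k : fieldType.

Lemma oppr1_neq0 : (-1 : k) != 0.
Proof. by rewrite oppr_eq0 oner_neq0. Qed.

(* The sign character of W = N/T = {1, s} inflated to N. *)
Definition sgn_fun (x : ntorus_group) : Gm k :=
  if val x \in @torus F then 1%g else (Sub (-1) oppr1_neq0 : Gm k).

Lemma torus_mul (x y : SL2) : x \in @torus F ->
  ((x * y)%g \in @torus F) = (y \in @torus F).
Proof.
have [T1 TD] := @torus_group_closed F; move=> xT.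
have xVT : x^-1%g \in @torus F by rewrite -[x^-1%g]mul1g TD.
apply/idP/idP => h; last by rewrite -[y]invgK TD // -[y^-1%g]mul1g TD.
have -> : y = (x^-1 / (x * y)^-1)%g by rewrite invgK mulKg.
by rewrite TD // -[(x * y)^-1%g]mul1g TD.
Qed.

Lemma sgn_funM : {morph sgn_fun : x y / (x * y)%g}.
Proof.
move=> x y; rewrite /sgn_fun gmulfM.
have [xT|xT] := boolP (val x \in @torus F).
  by rewrite torus_mul // mul1g.
have [yT|yT] := boolP (val y \in @torus F).
  rewrite mulg1 ifN //; apply: contra xT => xyT.
  have [T1 TD] := @torus_group_closed F.
  have -> : val x = (val x * val y / val y)%g by rewrite mulgK.
  exact: TD.
have [x00 x11] := ntorusP (valP x) xT; have [y00 y11] := ntorusP (valP y) yT.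
have -> : (val x * val y)%g \in @torus F.
  by apply/torusP; rewrite !SL2_mulE x00 x11 y00 y11 !mul0r !mulr0 !addr0.
by apply: val_inj; rewrite /= mulrNN mulr1.
Qed.
HB.instance Definition _ :=
  monoid.isMultiplicative.Build ntorus_group (Gm k) sgn_fun sgn_funM.

Definition sgn_char : {multiplicative ntorus_group -> Gm k} := sgn_fun.

End NormalizerTorus.

Section Modules.
Variables (F : closedFieldType) (k : fieldType).

Local Notation T := (torus_group F).
Local Notation B := (borel_group F).
Local Notation N := (ntorus_group F).

(* theta^s(t) = theta(sdot^-1 t sdot). *)
Definition twist_s (theta : {multiplicative T -> Gm k}) :
    {multiplicative T -> Gm k} :=
  theta \o @torus_s F.

Definition inflate (theta : {multiplicative T -> Gm k}) :
    {multiplicative B -> Gm k} :=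
  theta \o @borel_proj F.

Definition triv_mod : lmodType (galg k (SL2 F)) := char_mod (triv_char k (SL2 F)).

Definition IndN_plus : lmodType (galg k (SL2 F)) :=
  Ind (char_mod (triv_char k N)).

Definition IndN_minus : lmodType (galg k (SL2 F)) :=
  Ind (char_mod (sgn_char F k)).

Definition IndT (theta : {multiplicative T -> Gm k}) : lmodType (galg k (SL2 F)) :=
  Ind (char_mod theta).

Definition Mtheta (theta : {multiplicative T -> Gm k}) : lmodType (galg k (SL2 F)) :=
  Ind (char_mod (inflate theta)).

Definition one_tr : Mtheta (triv_char k T) :=
  ind_tens 1 ((1 : k) : char_mod (inflate (triv_char k T))).

Definition eta_s : Mtheta (triv_char k T) := (1 - gelt k (sdot F)) *: one_tr.

(* St is the submodule of M(tr) generated by eta_s. *)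
Definition St_pred : {pred Mtheta (triv_char k T)} := gen_submod (fun x => x = eta_s).

Definition Steinberg : lmodType (galg k (SL2 F)) := sub_mod St_pred.

End Modules.

(* Main.v *)
Require Import Defs.
From HB Require Import structures.
From mathcomp Require Import all_boot all_algebra all_solvable all_field.
From mathcomp.classical Require Import boolp functions.
From mathcomp Require Import finmap.
From mathcomp.multinomials Require Import monalg.
From mathcomp Require Import ring.

Set Implicit Arguments.
Unset Strict Implicit.
Unset Printing Implicit Defensive.
Import GRing.Theory.
Local Open Scope ring_scope.

(** Write G = SL_2(F), [u_x] and [l_x] for the upper and lower unitriangular
    matrices, [h_t] for diag(t, 1/t) and s for the Weyl element.  Every module
    in the statement is generated by one vector v on which the torus acts
    through a character th, so the task is to decide which relations [a v = 0],
    [a] in k[G], force [v = 0] in a quotient.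

    The field F is the union of its finite subfields E, and the proof averages
    over them.  Let [U_E] be the sum of the [u_x], x in E, and [L_E] the sum of
    the [l_(t^2)], t in E^*.  The torus conjugates [u_x] to [u_(t^2 x)], so
    [U_D v = 0] for one finite subfield D implies, after summing conjugates over
    a larger E, that (#E - #D) v = 0, hence [v = 0] as k has characteristic 0
    ([usum_eq0]).  It is therefore enough to kill [U_E v] for one E.

    By the Bruhat decomposition an element of G either lies in B, or in U T s,
    or has the form [u_x l_y h_t] with y nonzero.  Averaging g v over [U_E] and
    over the th-part of the torus of E turns these three types into multiples of
    [U_E v], [U_E s v] and [U_E L_E v] respectively, once E is large enough to
    contain the coordinates of g ([average_orbit]).  The multiple of [U_E s v]
    contains the sum of th^-2 over E^*, which is zero for large E if th is
    nontrivial, because F^* is divisible; if th is trivial, then s v is v or - v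
    in the modules at hand.  In both cases one relation [a v = 0] yields
    [al (#E - 1) U_E v + be U_E L_E v = 0] for all large E, where the scalars
    al and be do not depend on E.

    The four vanishing theorems exploit this.  If v is fixed by U
    ([borel_vanishing]), or if [s v = - v] ([minus_vanishing]), then [U_E L_E v]
    is zero, and [U_E v] alone survives.  Otherwise the relation for a field D
    is conjugated by s and averaged again over a much larger E: this gives a new
    relation whose coefficients depend affinely on #D, and comparing two fields
    D of different sizes isolates [U_E L_E v] ([plus_vanishing],
    [torus_vanishing]).

    The rest is bookkeeping.  The functionals that send a to the coefficients of
    the three Bruhat types are the coordinates of a principal series module:
    if [a 1_th] is nonzero in M(th), then so is the B-coefficient of some
    translate g a ([Mtheta_coef]).  Hence the vanishing theorems say
    that a submodule not contained in the kernel of Ind_N k_+ -> k_tr, or of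
    Ind_N k_- -> St, is everything, and that a proper submodule of Ind_T k_th is
    contained in one of the kernels of Ind_T k_th -> M(th), M(th^s), both of
    which are maximal.  Finally a U-fixed vector of M(th) is a multiple of the
    generator, since U is infinite, and so M(th) and M(th^s) are not isomorphic. *)

(** * Finite subfields *)

Section FiniteSubfields.
Variable F : fieldType.
Implicit Types (x y : F) (E D l : seq F).

(** A finite subfield is listed without repetition, which lets sums over it be
    written as big operators over a sequence. *)
Definition finite_subfield E : Prop :=
  [/\ uniq E, 1 \in E, {in E &, forall x y, x - y \in E},
      {in E &, forall x y, x * y \in E} & {in E, forall x, x^-1 \in E}].

Definition locally_finite : Prop :=
  forall l, exists2 E, finite_subfield E & {subset l <= E}.

(** Validity on all sufficiently large finite subfields; finitely many such
    conditions can be imposed at once. *)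
Definition eventually (P : seq F -> Prop) : Prop :=
  exists l, forall E, finite_subfield E -> {subset l <= E} -> P E.

Lemma eventually_mono (P Q : seq F -> Prop) :
  (forall E, finite_subfield E -> P E -> Q E) -> eventually P -> eventually Q.
Proof. by move=> PQ [l lP]; exists l => E fE lE; apply/PQ/lP. Qed.

Lemma eventually_and (P Q : seq F -> Prop) :
  eventually P -> eventually Q -> eventually (fun E => P E /\ Q E).
Proof.
move=> [l lP] [m mQ]; exists (l ++ m) => E fE lE.
by split; [apply: lP | apply: mQ] => // x xl; apply: lE; rewrite mem_cat xl ?orbT.
Qed.

Lemma eventually_mem x : eventually (fun E => x \in E).
Proof. by exists [:: x] => E _; apply; rewrite mem_head. Qed.

Lemma eventually_sub l : eventually (fun E => {subset l <= E}).
Proof. by exists l. Qed.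

Lemma eventuallyT (P : seq F -> Prop) :
  (forall E, finite_subfield E -> P E) -> eventually P.
Proof. by move=> PE; exists [::] => E fE _; apply: PE. Qed.

Section Closure.
Variables (E : seq F) (fE : finite_subfield E).

Lemma finsub_uniq : uniq E. Proof. by case: fE. Qed.
Lemma finsub1 : 1 \in E. Proof. by case: fE. Qed.
Lemma finsubB x y : x \in E -> y \in E -> x - y \in E.
Proof. by case: fE => _ _ h _ _; apply: h. Qed.
Lemma finsubM x y : x \in E -> y \in E -> x * y \in E.
Proof. by case: fE => _ _ _ h _; apply: h. Qed.
Lemma finsubV x : x \in E -> x^-1 \in E.
Proof. by case: fE => _ _ _ _; apply. Qed.
Lemma finsub0 : 0 \in E. Proof. by rewrite -(subrr 1) finsubB ?finsub1. Qed.
Lemma finsubN x : x \in E -> - x \in E.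
Proof. by rewrite -sub0r; apply/finsubB/finsub0. Qed.
Lemma finsubD x y : x \in E -> y \in E -> x + y \in E.
Proof. by move=> xE yE; rewrite -[y]opprK finsubB ?finsubN. Qed.

Lemma sum_split0 (V : nmodType) (f : F -> V) :
  \sum_(x <- E) f x = f 0 + \sum_(x <- E | x != 0) f x.
Proof.
rewrite (bigD1_seq 0) ?finsub0 ?finsub_uniq //=.
Qed.

(** Change of variables along h, with inverse h'. *)
Lemma reindex_fsub (V : nmodType) (h h' : F -> F) (P Q : pred F) (f : F -> V) :
  {in E, forall x, P x -> [&& h x \in E, Q (h x) & h' (h x) == x]} ->
  {in E, forall x, Q x -> [&& h' x \in E, P (h' x) & h (h' x) == x]} ->
  \sum_(x <- E | P x) f (h x) = \sum_(x <- E | Q x) f x.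
Proof.
move=> hP hQ; rewrite -[LHS]big_filter -[RHS]big_filter -(big_map h xpredT f).
apply: perm_big; apply: uniq_perm; rewrite ?filter_uniq ?finsub_uniq //.
  rewrite map_inj_in_uniq ?filter_uniq ?finsub_uniq // => x y.
  rewrite !mem_filter => /andP[Px xE] /andP[Py yE] e.
  have /and3P[_ _ /eqP <-] := hP x xE Px.
  by have /and3P[_ _ /eqP <-] := hP y yE Py; rewrite e.
move=> y; rewrite mem_filter; apply/mapP/andP => [[x]|[Qy yE]].
  by rewrite mem_filter => /andP[Px xE] ->; have /and3P[] := hP x xE Px.
have /and3P[h1 h2 /eqP h3] := hQ y yE Qy.
by exists (h' y); rewrite ?mem_filter ?h2.
Qed.

Lemma sum_fsub_shift (V : nmodType) (f : F -> V) a : a \in E ->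
  \sum_(x <- E) f (a + x) = \sum_(x <- E) f x.
Proof.
move=> aE; apply: (reindex_fsub (h' := fun x => x - a)) => x xE _ /=.
  by rewrite finsubD //= addrAC subrr add0r.
by rewrite finsubB //= addrC subrK.
Qed.

Lemma sum_fsub_scale (V : nmodType) (f : F -> V) a : a \in E -> a != 0 ->
  \sum_(x <- E | x != 0) f (a * x) = \sum_(x <- E | x != 0) f x.
Proof.
move=> aE a0; apply: (reindex_fsub (h' := fun x => a^-1 * x)) => x xE x0 /=.
  by rewrite finsubM // mulf_neq0 //= mulKf.
by rewrite finsubM ?finsubV // mulf_neq0 ?invr_eq0 //= mulVKf.
Qed.

Lemma sum_fsub_div (V : nmodType) (f : F -> V) a : a \in E -> a != 0 ->
  \sum_(x <- E | x != 0) f (a / x) = \sum_(x <- E | x != 0) f x.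
Proof.
move=> aE a0; apply: (reindex_fsub (h' := fun x => a / x)) => x xE x0 /=;
by rewrite finsubM ?finsubV // mulf_neq0 ?invr_eq0 //= invf_div mulrC divfK.
Qed.

End Closure.
End FiniteSubfields.

Lemma closed_roots (F : closedFieldType) (P : {poly F}) : P != 0 ->
  exists s : seq F, uniq s /\ forall x, (x \in s) = root P x.
Proof.
move=> P0; have [r Pr] := closed_field_poly_normal P.
exists (undup r); split=> [|x]; first exact: undup_uniq.
by rewrite mem_undup Pr rootZ ?lead_coef_eq0 // root_prod_XsubC.
Qed.

(** The polynomial 1 + X prod (X - a) has a root, and no a is one. *)
Lemma closed_infinite (F : closedFieldType) (l : seq F) : exists x, x \notin l.
Proof.
pose p := \prod_(a <- 0 :: l) ('X - a%:P); pose P := p + 1.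
have sp : size p = (size l).+2 by rewrite size_prod_XsubC.
have sP : size P != 1%N by rewrite size_polyDl ?size_poly1 sp.
have [x Px] := closed_rootP _ sP; exists x; apply/negP => xl.
have : root p x by rewrite root_prod_XsubC inE xl orbT.
move: Px; rewrite /root hornerD => Px /eqP e.
by move: Px; rewrite e add0r hornerC oner_eq0.
Qed.

Lemma closed_sqrt (F : closedFieldType) (x : F) : exists y, y ^+ 2 = x.
Proof.
have [y] := @solve_monicpoly F 2 (fun i => if i == 0%N then x else 0) isT.
rewrite !big_ord_recl big_ord0 /= mul0r expr0 mulr1 !addr0.
by exists y.
Qed.

(** The q-power map is injective and preserves the finite set of roots of a
    polynomial over F_q, so each algebraic x satisfies [x ^ (q ^ d) = x] for some
    d > 0.  Finitely many elements then share one exponent D, and the roots of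
    X^(q^D) - X form a finite subfield because Frobenius is additive. *)
Lemma algebraic_locally_finite (Fq : finFieldType) (F : closedFieldType)
    (iota : {rmorphism Fq -> F}) :
  (forall x : F, algebraicOver iota x) -> locally_finite F.
Proof.
move=> algF; have [p p_pr pq] := finPcharP Fq.
have pF : p \in [pchar F] by rewrite (rmorph_pchar iota).
have qF : [pchar F].-nat #|Fq|.
  have: p.-nat #|Fq|.
    by have := abelem_pgroup (fin_ring_pchar_abelem pq); rewrite /pgroup cardsT.
  by apply: sub_in_pnat => r _; rewrite inE => /eqP ->.
set q := #|Fq| in qF.
have q1 : (1 < q)%N by exact: finNzRing_gt1.
have frobB m (x y : F) : (x - y) ^+ (q ^ m) = x ^+ (q ^ m) - y ^+ (q ^ m).
  have h : [pchar F].-nat (q ^ m)%N by rewrite pnatX qF.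
  by rewrite exprDn_pchar // exprNn_pchar.
have per (x : F) : exists2 d, (0 < d)%N & x ^+ (q ^ d) = x.
  have [P P0 Px] := algF x.
  have PF0 : map_poly iota P != 0 by rewrite map_poly_eq0.
  have [s [_ sP]] := closed_roots PF0.
  have ms m : x ^+ (q ^ m) \in s.
    rewrite sP; elim: m => [|m Py]; first by rewrite expn0 expr1.
    rewrite expnSr exprM; move: (x ^+ _) Py => z /eqP Pz; apply/eqP.
    have -> : (map_poly iota P).[z ^+ q] = (map_poly iota P).[z] ^+ q.
      rewrite !horner_coef (big_morph (fun u => u ^+ q) (id1 := 0) (op1 := +%R)).
      - apply: eq_bigr => i _; rewrite exprMn coef_map -rmorphXn expf_card.
        by rewrite -!exprM mulnC.
      - by move=> u w; rewrite exprDn_pchar.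
      by rewrite expr0n; case: q q1 {qF frobB}.
    by rewrite Pz expr0n; case: q q1 {qF frobB}.
  have [i [j [ij xij]]] : exists i j, (i < j)%N /\ x ^+ (q ^ i) = x ^+ (q ^ j).
    apply: contrapT => h.
    have us: uniq (mkseq (fun i => x ^+ (q ^ i)) (size s).+1).
      rewrite /mkseq map_inj_in_uniq ?iota_uniq // => i j _ _ e.
      have [ij|ji|//] := ltngtP i j; case: h; [exists i, j|exists j, i]; by split.
    have := @uniq_leq_size _ _ s us; rewrite size_mkseq ltnn.
    by move=> h2; suff: false by []; apply: h2 => _ /mapP[i _ ->].
  (* Injectivity of Frobenius cancels the q ^ i-th power. *)
  exists (j - i)%N; first by rewrite subn_gt0.
  apply/eqP; rewrite -subr_eq0; have /eqP := frobB i (x ^+ (q ^ (j - i))) x.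
  rewrite -exprM -expnD subnK ?(ltnW ij) // xij subrr expf_eq0.
  by move=> /andP[].
move=> l.
have [D D0 Dl] : exists2 D, (0 < D)%N & {in l, forall x, x ^+ (q ^ D) = x}.
  elim: l => [|a l [D D0 Dl]]; first by exists 1%N.
  have [d d0 da] := per a.
  have it e c (x : F) : x ^+ (q ^ e) = x -> x ^+ (q ^ (e * c)) = x.
    by move=> xe; elim: c => [|c IH]; rewrite ?muln0 ?expr1 // mulnS expnD exprM xe.
  exists (D * d)%N; first by rewrite muln_gt0 D0.
  by move=> x; rewrite inE => /predU1P[->|xl]; [rewrite mulnC|]; apply: it => //; apply: Dl.
have QD : (1 < q ^ D)%N by rewrite -{1}(exp1n D) ltn_exp2r.
have P0 : 'X^(q ^ D) - 'X != 0 :> {poly F}.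
  rewrite -size_poly_eq0 size_polyDl ?size_polyXn // size_polyN size_polyX.
  by rewrite ltnS.
have [E [uE EP]] := closed_roots P0.
have inE x : (x \in E) = (x ^+ (q ^ D) == x).
  by rewrite EP /root !hornerE subr_eq0.
exists E; last by move=> x xl; rewrite inE Dl.
split=> // [|x y|x y|x]; rewrite !inE ?expr1n // ?frobB ?exprMn ?exprVn.
- by move=> /eqP -> /eqP ->.
- by move=> /eqP -> /eqP ->.
by move=> /eqP ->.
Qed.

(** * Scalars and functionals on a group algebra *)

(** Scalars act on a k[G]-module through the multiples of the identity of G.
    The constant is locked because unification would otherwise compare elements
    of the group algebra by expanding convolution products. *)
HB.lock Definition scal (k : fieldType) (G : groupType) (c : k) : galg k G :=
  << c *g 1%g >>.
Arguments scal {k G} c.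

Section Scalars.
Variables (k : fieldType) (G : groupType).
Implicit Types (a b : galg k G) (c : k) (g : G) (f : G -> k).
Local Notation scal := (@scal k G).

Lemma scal_is_zmod_morphism : zmod_morphism scal.
Proof. by move=> c d; rewrite scal.unlock monalgUB. Qed.
HB.instance Definition _ :=
  GRing.isZmodMorphism.Build k (galg k G) scal scal_is_zmod_morphism.

Lemma scal_is_monoid_morphism : monoid_morphism scal.
Proof.
split=> [|c d]; first by rewrite scal.unlock -[RHS]/(gelt k 1%g) gelt.unlock.
by rewrite scal.unlock [RHS]galg_mulUU mulg1.
Qed.
HB.instance Definition _ :=
  GRing.isMonoidMorphism.Build k (galg k G) scal scal_is_monoid_morphism.

Lemma scal_gelt c g : scal c * gelt k g = << c *g g >>.
Proof. by rewrite gelt.unlock scal.unlock [LHS]galg_mulUU mulr1 mul1g. Qed.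

Lemma galg_ind (P : galg k G -> Prop) :
  P 0 -> (forall a b, P a -> P b -> P (a + b)) ->
  (forall c g, P (scal c * gelt k g)) -> forall a, P a.
Proof.
by move=> P0 PD PU; apply: malg_ind => // c g; rewrite -scal_gelt.
Qed.

Lemma scalC c a : scal c * a = a * scal c.
Proof.
elim/galg_ind: a => [|a b IHa IHb|d g]; first by rewrite mulr0 mul0r.
  by rewrite mulrDr mulrDl IHa IHb.
rewrite mulrA -rmorphM /= mulrC !scal_gelt scal.unlock [RHS]galg_mulUU mulg1.
by rewrite mulrC.
Qed.

Lemma scalCA c a b : scal c * (a * b) = a * (scal c * b).
Proof. by rewrite mulrA scalC mulrA. Qed.

(** The linear extension of a function on G to k[G]. *)
Definition pairing f a : k := \sum_(g <- msupp a) a@_g * f g.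

Lemma pairingEw f (d : {fset G}) a : fsubset (msupp a) d ->
  pairing f a = \sum_(g <- d) a@_g * f g.
Proof.
move=> le; rewrite /pairing (big_fset_incl _ le) //= => g _ /mcoeff_outdom ->.
by rewrite mul0r.
Qed.

Lemma pairing_is_zmod_morphism f : zmod_morphism (pairing f).
Proof.
move=> a b; set d := fsetU (msupp a) (msupp b).
have [da db] : fsubset (msupp a) d /\ fsubset (msupp b) d.
  by rewrite fsubsetUl fsubsetUr.
rewrite (pairingEw f da) (pairingEw f db) (pairingEw f (msuppB_le a b)) -sumrB.
by apply: eq_bigr => h _; rewrite mcoeffB mulrBl.
Qed.
HB.instance Definition _ f := GRing.isZmodMorphism.Build (galg k G) k (pairing f)
  (pairing_is_zmod_morphism f).

Lemma pairingU f c g : pairing f << c *g g >> = c * f g.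
Proof. by rewrite (pairingEw f msuppU_le) big_seq_fset1 mcoeffUU. Qed.

Lemma pairing_gelt f g : pairing f (gelt k g) = f g.
Proof. by rewrite gelt.unlock pairingU mul1r. Qed.

Lemma pairing_of_scal f c : pairing f (scal c) = c * f 1%g.
Proof. by rewrite scal.unlock pairingU. Qed.

Lemma pairing_scal f c a : pairing f (scal c * a) = c * pairing f a.
Proof.
elim/galg_ind: a => [|a b IHa IHb|d g]; first by rewrite mulr0 raddf0 mulr0.
  by rewrite mulrDr !raddfD /= IHa IHb mulrDr.
by rewrite mulrA -rmorphM !scal_gelt !pairingU mulrA.
Qed.

Lemma pairing_mul f a b :
  pairing f (a * b) = pairing (fun g => pairing (fun h => f (g * h)%g) b) a.
Proof.
elim/galg_ind: a => [|a a' IHa IHb|c g]; first by rewrite mul0r !raddf0.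
  by rewrite mulrDl !raddfD /= IHa IHb.
rewrite -mulrA !pairing_scal pairing_gelt; congr (_ * _).
elim/galg_ind: b => [|b b' IHa IHb|d h]; first by rewrite mulr0 !raddf0.
  by rewrite mulrDr !raddfD /= IHa IHb.
by rewrite -scalCA geltM !pairing_scal !pairing_gelt.
Qed.

Lemma pairing_sandwich f a b (u l : galg k G) c d :
  pairing f (a * (u * (scal c + scal d * l)) * b) =
  c * pairing f (a * u * b) + d * pairing f (a * (u * l) * b).
Proof.
rewrite -!pairing_scal -raddfD /=; congr (pairing f _).
rewrite mulrDr -(scalC c) -(scalCA d) mulrDr -(scalCA c) -(scalCA d) mulrDl.
by rewrite -(mulrA (scal c)) -(mulrA (scal d)).
Qed.

Lemma eq_pairing f f' : f =1 f' -> pairing f =1 pairing f'.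
Proof. by move=> ff a; rewrite /pairing; apply: eq_bigr => g _; rewrite ff. Qed.

Lemma pairing_mul_1B f a g :
  pairing f (a * (1 - gelt k g)) = pairing f a - pairing (fun h => f (h * g)%g) a.
Proof.
rewrite mulrBr mulr1 raddfB /= pairing_mul; congr (_ - _).
by apply: eq_pairing => h; rewrite pairing_gelt.
Qed.

Lemma pairingDf f f' a : pairing (fun g => f g + f' g) a = pairing f a + pairing f' a.
Proof. by rewrite /pairing -big_split /=; apply: eq_bigr => g _; rewrite mulrDr. Qed.

(** G acts by right translation; this module is the target of the embedding of
    an induced module given by matrix coefficients. *)
Definition coind : Type := G -> k.
HB.instance Definition _ := GRing.Zmodule.on coind.

Definition coind_scale a (f : coind) : coind :=
  fun x => pairing (fun g => f (x * g)%g) a.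

Lemma coind_scaleA a b f : coind_scale a (coind_scale b f) = coind_scale (a * b) f.
Proof.
apply/funext => x; rewrite /coind_scale pairing_mul; apply: eq_pairing => g.
by apply: eq_pairing => h; rewrite mulgA.
Qed.
Lemma coind_scale1 : left_id 1 coind_scale.
Proof.
by move=> f; apply/funext => x; rewrite /coind_scale -[1]/(gelt k 1%g) pairing_gelt mulg1.
Qed.
Lemma coind_scaleDr : right_distributive coind_scale +%R.
Proof. by move=> a f g; apply/funext => x; rewrite /coind_scale pairingDf. Qed.
Lemma coind_scaleDl f : {morph coind_scale^~ f : a b / a + b}.
Proof. by move=> a b; apply/funext => x; rewrite /coind_scale raddfD. Qed.
HB.instance Definition _ := GRing.Zmodule_isLmodule.Build (galg k G) coind
  coind_scaleA coind_scale1 coind_scaleDr coind_scaleDl.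

Lemma coindE a (f : coind) x : (a *: f) x = pairing (fun g => f (x * g)%g) a.
Proof. by []. Qed.

Variable V : lmodType (galg k G).
Implicit Type v : V.

Lemma scaler_scalC c a v : a *: (scal c *: v) = scal c *: (a *: v).
Proof. by rewrite !scalerA scalC. Qed.

Lemma scalZ c d v : scal c *: (scal d *: v) = scal (c * d) *: v.
Proof. by rewrite scalerA rmorphM. Qed.

Lemma scal_eq0 c v : scal c *: v = 0 -> c != 0 -> v = 0.
Proof.
move=> cv c0; rewrite -[v]scale1r -[1](rmorph1 scal) -(mulVf c0) rmorphM -scalerA.
by rewrite cv scaler0.
Qed.

Lemma geltZ g h v : gelt k g *: (gelt k h *: v) = gelt k (g * h)%g *: v.
Proof. by rewrite scalerA geltM. Qed.

Lemma gelt1Z v : gelt k (1%g : G) *: v = v. Proof. exact: scale1r. Qed.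

Lemma gelt_eq0 g v : gelt k g *: v = 0 -> v = 0.
Proof. by move=> e; rewrite -[v]gelt1Z -(mulVg g) -geltZ e scaler0. Qed.

Lemma orbit_submod_closed v : submod_closed (fun x : V => `[< exists a, x = a *: v >]).
Proof.
split=> [|a x y].
  by apply/asboolP; exists 0; rewrite scale0r.
move=> /asboolP[b ->] /asboolP[c ->]; apply/asboolP.
by exists (a * b + c); rewrite scalerDl scalerA.
Qed.

End Scalars.

Lemma char_scalE (k : fieldType) (G : groupType) (chi : {multiplicative G -> Gm k})
    (c : k) (v : char_mod chi) : scal c *: v = c * v :> k.
Proof.
rewrite -[LHS]/(char_ev chi (scal c) * (v : k)) scal.unlock char_evU.
by rewrite multiplicative1 /= mulr1.
Qed.

(** * Modules induced from a character *)

Section InducedCharacter.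
Variables (k : fieldType) (K : groupType) (P : pred K) (H : subGroupType P).
Variable chi : {multiplicative H -> Gm k}.

Definition ind_gen : Ind (char_mod chi) := ind_tens 1 ((1 : k) : char_mod chi).

Lemma galg_map_scal (c : k) : galg_map val (scal c : galg k H) = scal c :> galg k K.
Proof.
rewrite -[scal c]mulr1 -[1]/(gelt k 1%g) scal_gelt /galg_map malg_mapU.
by rewrite scal.unlock (multiplicative1 (val : {multiplicative H -> K})).
Qed.

Lemma ind_genP (m : Ind (char_mod chi)) : exists a, m = a *: ind_gen.
Proof.
elim/tensor_ind: m => [|t u [a ->] [b ->]|t [a ->]|x v].
- by exists 0; rewrite scale0r.
- by exists (a + b); rewrite scalerDl.
- by exists (- a); rewrite scaleNr.
exists (x * scal v); rewrite ind_tens_scale mulr1 /ind_tens -galg_map_scal tensM.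
by congr (tens _ _ _); rewrite char_scalE mulr1.
Qed.

Lemma ind_gen_char (h : H) : gelt k (val h) *: ind_gen = scal (val (chi h)) *: ind_gen.
Proof.
rewrite !ind_tens_scale !mulr1 -[gelt k _]mul1r ind_tens_gelt.
rewrite -galg_map_scal -[galg_map _ _]mul1r [RHS]tensM; congr (tens _ _ _).
by rewrite gelt_scaleE char_scalE.
Qed.

(** Frobenius reciprocity for a character. *)
Lemma ind_map (W : lmodType (galg k K)) (w : W) :
  (forall h : H, gelt k (val h) *: w = scal (val (chi h)) *: w) ->
  exists f : {linear Ind (char_mod chi) -> W}, f ind_gen = w.
Proof.
move=> hw; pose g (c : char_mod chi) : W := scal (c : k) *: w.
have gB : zmod_morphism g by move=> c d; rewrite /g raddfB scalerBl.
pose gI := GRing.isZmodMorphism.Build (char_mod chi) W g gB.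
pose gA : {additive char_mod chi -> W} := HB.pack g gI.
have [r v|f fE] := @tensor_universal _ _ (@galg_map k K H val) _ W gA.
  rewrite -[LHS]/(g (r *: v)) -[gA v]/(g v).
  elim/galg_ind: r => [|a b IHa IHb|c h].
  - by rewrite raddf0 !scale0r /g raddf0 scale0r.
  - by rewrite raddfD !scalerDl -IHa -IHb /g raddfD scalerDl.
  rewrite rmorphM /= galg_map_scal galg_map_gelt -!scalerA.
  rewrite /g [gelt k _ *: (scal _ *: _)]scaler_scalC hw !scalerA -!rmorphM.
  congr (scal _ *: _); by rewrite -scalerA char_scalE gelt_scaleE [X in c * X]mulrC.
exists f; rewrite /ind_gen /ind_tens fE scale1r.
by rewrite -[gA 1]/(g 1) /g rmorph1 scale1r.
Qed.

(** The character, extended by zero outside of the subgroup: the coordinate of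
    g (1 (x) 1) along 1 (x) 1. *)
Definition ext0 (g : K) : k := if insub g is Some h then val (chi h) else 0.

Lemma ext0_val (h : H) : ext0 (val h) = val (chi h).
Proof. by rewrite /ext0 valK. Qed.

Lemma ext0_out g : ~~ P g -> ext0 g = 0.
Proof. by move=> gP; rewrite /ext0 insubF //; apply: negbTE. Qed.

Lemma subgroup_val g : P g -> exists x : H, val x = g.
Proof. by move=> gP; exists (Sub g gP); apply: SubK. Qed.

Lemma ext0Mr g (h : H) : ext0 (g * val h)%g = ext0 g * val (chi h).
Proof.
have [/subgroup_val[x <-]|gP] := boolP (P g).
  by rewrite -gmulfM !ext0_val gmulfM.
rewrite !ext0_out ?mul0r //; apply: contra gP => /subgroup_val[x xE].
have -> : g = val (x / h)%g by rewrite gmulfM gmulfV /= xE mulgK.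
exact: valP.
Qed.

Lemma ext0Ml g (h : H) : ext0 (val h * g)%g = val (chi h) * ext0 g.
Proof.
have [/subgroup_val[x <-]|gP] := boolP (P g).
  by rewrite -gmulfM !ext0_val gmulfM.
rewrite !ext0_out ?mulr0 //; apply: contra gP => /subgroup_val[x xE].
have -> : g = val (h^-1 * x)%g by rewrite gmulfM gmulfV /= xE mulKg.
exact: valP.
Qed.

Lemma ext0_neq0 g : (ext0 g != 0) = P g.
Proof.
have [/subgroup_val[x <-]|gP] := boolP (P g); last by rewrite ext0_out ?eqxx.
by rewrite ext0_val (valP (chi _)).
Qed.

(** The map sends [ind_gen] to [ext0]; evaluating the image of a vector at 1
    shows that the coordinate of [a *: ind_gen] depends on that vector only. *)
Lemma ind_coef : exists Phi : {linear Ind (char_mod chi) -> coind k K},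
  forall a, Phi (a *: ind_gen) 1%g = pairing ext0 a.
Proof.
have [h|f fE] := @ind_map (coind k K) (ext0 : coind k K).
  apply/funext => x; rewrite !coindE pairing_gelt ext0Mr.
  by rewrite -[scal _]mulr1 -[1]/(gelt k 1%g) pairing_scal pairing_gelt mulg1 mulrC.
exists f => a; rewrite linearZ /= fE coindE.
by apply: eq_pairing => g; rewrite mul1g.
Qed.

Lemma ind_gen_neq0 : ind_gen != 0.
Proof.
have [Phi PhiE] := ind_coef; apply/eqP => e; have := PhiE 1.
rewrite scale1r e raddf0 -[1]/(gelt k 1%g) pairing_gelt.
rewrite -(multiplicative1 (val : {multiplicative H -> K})) ext0_val.
by move=> /esym/eqP; apply/negP; apply: (valP (chi _)).
Qed.

Lemma pairing_ext0_wd a b : a *: ind_gen = b *: ind_gen -> pairing ext0 a = pairing ext0 b.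
Proof. by have [Phi PhiE] := ind_coef; rewrite -!PhiE => ->. Qed.

(** Terms of [a *: w] over the same left coset are merged one coset at a time.
    If every translated coordinate of [a *: w] is zero, then so is the coefficient
    of the coset that is singled out, and the number of terms drops. *)
Lemma eigen_coef_neq0 (W : lmodType (galg k K)) (w : W) a :
  (forall h : H, gelt k (val h) *: w = scal (val (chi h)) *: w) ->
  (forall b c, b *: w = c *: w -> pairing ext0 b = pairing ext0 c) ->
  a *: w != 0 -> exists g, pairing ext0 (gelt k g * a) != 0.
Proof.
move=> w_char wd a0; apply: contrapT => h; case/negP: a0; apply/eqP.
have {}h g : pairing ext0 (gelt k g * a) = 0.
  by apply: contrapT => /eqP e; apply: h; exists g.
suff: forall s : seq (k * K),
    a *: w = \sum_(p <- s) scal p.1 *: (gelt k p.2 *: w) -> a *: w = 0.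
  move=> /(_ [seq (a@_g, g) | g <- msupp a]); apply; rewrite big_map.
  under eq_bigr do rewrite scalerA scal_gelt.
  by rewrite -scaler_suml; congr (_ *: _); apply: monalgE.
move=> s; have [n] := ubnP (size s); elim: n s => // n IH [_ ->|[c g] s /= sn aE].
  by rewrite big_nil.
(* The terms that lie outside of the coset g H. *)
pose far (p : k * K) := ~~ P (g^-1 * p.2)%g.
have absorb p : ~~ far p ->
    gelt k p.2 *: w = scal (ext0 (g^-1 * p.2)%g) *: (gelt k g *: w).
  rewrite negbK => /subgroup_val[x xE].
  have -> : p.2 = (g * val x)%g by rewrite xE mulVKg.
  rewrite mulKg -geltZ w_char ext0_val.
  by rewrite scaler_scalC.
have [d dE] : exists d, a *: w = scal d *: (gelt k g *: w) +
    \sum_(p <- filter far s) scal p.1 *: (gelt k p.2 *: w).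
  exists (c + \sum_(p <- s | ~~ far p) p.1 * ext0 (g^-1 * p.2)%g).
  have near : \sum_(p <- s | ~~ far p) scal p.1 *: (gelt k p.2 *: w) =
      scal (\sum_(p <- s | ~~ far p) p.1 * ext0 (g^-1 * p.2)%g) *: (gelt k g *: w).
    rewrite rmorph_sum scaler_suml; apply: eq_bigr => p pf.
    by rewrite (absorb p pf) scalZ.
  by rewrite aE big_cons (bigID far) near big_filter rmorphD scalerDl addrCA addrC.
suff d0 : d = 0.
  apply: (IH (filter far s)); last by rewrite dE d0 raddf0 scale0r add0r.
  by move: sn; rewrite ltnS; apply: leq_ltn_trans; rewrite size_filter count_size.
pose a' := scal d * gelt k g + \sum_(p <- filter far s) scal p.1 * gelt k p.2.
have aE2 : a *: w = a' *: w.
  rewrite dE scalerDl -scalerA; congr (_ + _); rewrite scaler_suml.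
  by apply: eq_bigr => p _; rewrite scalerA.
have := h g^-1%g; rewrite (wd _ (gelt k g^-1%g * a')); last first.
  by rewrite -scalerA aE2 scalerA.
rewrite /a' mulrDr raddfD /= -scalCA geltM mulVg pairing_scal pairing_gelt.
rewrite big_filter mulr_sumr raddf_sum big1 => [|p pf]; last first.
  by rewrite /= -scalCA geltM pairing_scal pairing_gelt ext0_out ?mulr0.
rewrite addr0 => /eqP; rewrite mulf_eq0 => /orP[/eqP //|/negPn].
rewrite ext0_neq0 => /negP[].
by rewrite -(multiplicative1 (val : {multiplicative H -> K})) valP.
Qed.

Lemma ind_coef_neq0 a : a *: ind_gen != 0 ->
  exists g, pairing ext0 (gelt k g * a) != 0.
Proof. by apply: eigen_coef_neq0 ind_gen_char _; apply: pairing_ext0_wd. Qed.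

End InducedCharacter.

(** * Elements of SL_2 and the Bruhat decomposition *)

Section Elements.
Variable F : fieldType.
Local Notation SL2 := (SL2 F).

Lemma upper_det (x : F) : \det (mx2 1 x 0 1) == 1.
Proof. by apply: mx2_det; ring. Qed.
Lemma lower_det (x : F) : \det (mx2 1 0 x 1) == 1.
Proof. by apply: mx2_det; ring. Qed.

Definition upper (x : F) : SL2 := Sub (mx2 1 x 0 1) (upper_det x).
Definition lower (x : F) : SL2 := Sub (mx2 1 0 x 1) (lower_det x).
(** A total function, with the identity matrix as its value at 0, avoids carrying
    proofs of t != 0 in sums over a field. *)
Definition diag (t : F) : SL2 := insubd (1%g : SL2) (mx2 t 0 0 t^-1 : 'M[F]_2).

Lemma upperE (x : F) :
  ((val (upper x) 0 0 = 1) * (val (upper x) 0 1 = x) *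
   (val (upper x) 1 0 = 0) * (val (upper x) 1 1 = 1))%type.
Proof. by rewrite /= !mx2E. Qed.

Lemma lowerE (x : F) :
  ((val (lower x) 0 0 = 1) * (val (lower x) 0 1 = 0) *
   (val (lower x) 1 0 = x) * (val (lower x) 1 1 = 1))%type.
Proof. by rewrite /= !mx2E. Qed.

Lemma sdotE :
  ((val (sdot F) 0 0 = 0) * (val (sdot F) 0 1 = 1) *
   (val (sdot F) 1 0 = -1) * (val (sdot F) 1 1 = 0))%type.
Proof. by rewrite /= !mx2E. Qed.

Lemma diagE (t : F) : t != 0 ->
  ((val (diag t) 0 0 = t) * (val (diag t) 0 1 = 0) *
   (val (diag t) 1 0 = 0) * (val (diag t) 1 1 = t^-1))%type.
Proof.
move=> t0; have d : \det (mx2 t 0 0 t^-1) == 1.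
  by apply: mx2_det; rewrite mulfV // mulr0 subr0.
by rewrite /diag val_insubd d !mx2E.
Qed.

Lemma SL2invE (A : SL2) :
  ((val A^-1%g 0 0 = val A 1 1) * (val A^-1%g 0 1 = - val A 0 1) *
   (val A^-1%g 1 0 = - val A 1 0) * (val A^-1%g 1 1 = val A 0 0))%type.
Proof. by rewrite !SL2_invE !mx2E. Qed.

Definition entryE := (SL2_mulE, upperE, lowerE, sdotE, SL2invE).

Lemma upperD x y : (upper x * upper y)%g = upper (x + y).
Proof. by apply: SL2P; rewrite !entryE; ring. Qed.

Lemma upper0 : upper 0 = 1%g.
Proof. by apply: (@mulgI _ (upper 0)); rewrite upperD addr0 mulg1. Qed.

Lemma diag_upper t x : t != 0 -> (diag t * upper x)%g = (upper (t ^+ 2 * x) * diag t)%g.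
Proof. by move=> t0; apply: SL2P; rewrite !(entryE, diagE t0); field. Qed.

Lemma diag_lower t x : t != 0 -> (diag t * lower x)%g = (lower (x / t ^+ 2) * diag t)%g.
Proof. by move=> t0; apply: SL2P; rewrite !(entryE, diagE t0); field. Qed.

Lemma diag_sdot t : t != 0 -> (diag t * sdot F)%g = (sdot F * diag t^-1)%g.
Proof.
move=> t0; have tV0 : t^-1 != 0 by rewrite invr_eq0.
by apply: SL2P; rewrite !(entryE, diagE t0, diagE tV0) ?invrK; ring.
Qed.

Variable g : SL2.
Local Notation p := (val g 0 0).
Local Notation q := (val g 0 1).
Local Notation r := (val g 1 0).
Local Notation s := (val g 1 1).

(** Up to its torus component, g is determined by the images of the points
    infinity and 0 of the projective line; the three decompositions below
    distinguish whether infinity is the first image, the second image or neither,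
    and the upper unitriangular factor carries 0 to a finite image. *)
Lemma borel_decomp : r = 0 -> p != 0 /\ g = (upper (q / s) * diag p)%g.
Proof.
move=> r0; have := SL2_detE g; rewrite r0 mulr0 subr0 => d.
have p0 : p != 0 by apply/eqP => p0; move/eqP: d; rewrite p0 mul0r eq_sym oner_eq0.
have sE : s = p^-1 by apply: (mulfI p0); rewrite d mulfV.
split=> //; apply: SL2P; rewrite !(entryE, diagE p0) ?r0 ?sE; field;
  by rewrite ?p0 ?oner_neq0.
Qed.

Lemma coborel_decomp : s = 0 -> [/\ r != 0, q != 0 &
  g = (upper (- (p * q)) * (diag q * sdot F))%g].
Proof.
move=> s0; have := SL2_detE g; rewrite s0 mulr0 sub0r => d.
have q0 : q != 0 by apply/eqP => q0; move/eqP: d; rewrite q0 mul0r oppr0 eq_sym oner_eq0.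
have rE : r = - q^-1 by apply: (mulfI q0); rewrite mulrN mulfV // -[LHS]opprK d.
split=> //; first by rewrite rE oppr_eq0 invr_eq0.
by apply: SL2P; rewrite !(entryE, diagE q0) ?s0 ?rE; field; rewrite ?q0 ?oner_neq0.
Qed.

Lemma big_cell_decomp : s != 0 ->
  g = (upper (q / s) * (lower (r * s) * diag s^-1))%g.
Proof.
move=> s0; have sV0 : s^-1 != 0 by rewrite invr_eq0.
have pE : p = (1 + q * r) / s.
  by apply: (mulIf s0); rewrite divfK // -[LHS](subrK (q * r)) SL2_detE.
by apply: SL2P; rewrite !(entryE, diagE sV0) ?pE; field; rewrite ?s0 ?oner_neq0.
Qed.

End Elements.

(** * Averages over finite subgroups of the Borel subgroup *)

(** These three elements are locked for the same reason as [scal]. *)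
HB.lock Definition usum (F k : fieldType) (E : seq F) : galg k (SL2 F) :=
  \sum_(x <- E) gelt k (upper x).
HB.lock Definition lsum (F k : fieldType) (E : seq F) : galg k (SL2 F) :=
  \sum_(t <- E | t != 0) gelt k (lower (t ^+ 2)).
(** Up to scalars, the projector onto the vectors that are fixed by the unipotent
    matrices over E and on which the torus over E acts through th. *)
HB.lock Definition average (F k : fieldType) (th : F -> k) (E : seq F) : galg k (SL2 F) :=
  usum k E * \sum_(t <- E | t != 0) scal (th t)^-1 * gelt k (diag t).

Section Averaging.
Variables (F : closedFieldType) (k : fieldType).
Local Notation SL2 := (SL2 F).
Local Notation kG := (galg k SL2).
Local Notation "g ** v" := (gelt k g *: v) (at level 36, right associativity, only parsing).
Local Notation S := (sdot F).
Implicit Type E : seq F.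
Local Notation usum := (usum k).
Local Notation lsum := (lsum k).

Definition nunits E : k := \sum_(t <- E | t != 0) 1.

Section Character.
Variable th : F -> k.
Local Notation average := (average th).

(** Coefficients of the three Bruhat types: g fixes infinity, g sends 0 to
    infinity, or neither.  The values record the scalar that the torus component
    of g contributes on a vector of eigencharacter th. *)
Definition borel_coef (g : SL2) : k := if val g 1 0 == 0 then th (val g 0 0) else 0.
Definition weyl_coef (g : SL2) : k := if val g 1 1 == 0 then (th (val g 0 1))^-1 else 0.
Definition generic_coef (g : SL2) : k :=
  if (val g 1 0 != 0) && (val g 1 1 != 0) then (th (val g 1 1))^-1 else 0.

Definition mult_char :=
  (forall a b, a != 0 -> b != 0 -> th (a * b) = th a * th b) /\
  (forall a, a != 0 -> th a != 0).

Definition eigenvector (V : lmodType kG) (v : V) :=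
  forall a, a != 0 -> diag a ** v = scal (th a) *: v.

Hypothesis thP : mult_char.

Lemma mult_charM a b : a != 0 -> b != 0 -> th (a * b) = th a * th b.
Proof. by case: thP => h _; apply: h. Qed.
Lemma mult_char_neq0 a : a != 0 -> th a != 0. Proof. by case: thP => _; apply. Qed.
Lemma mult_char1 : th 1 = 1.
Proof.
apply: (mulfI (mult_char_neq0 (oner_neq0 F))).
by rewrite mulr1 -mult_charM ?mulr1 ?oner_neq0.
Qed.
Lemma mult_charV a : a != 0 -> th a^-1 = (th a)^-1.
Proof.
move=> a0; apply: (mulfI (mult_char_neq0 a0)).
by rewrite -mult_charM ?invr_eq0 // !mulfV ?mult_char1 ?mult_char_neq0.
Qed.

(** Multiplying the variable by [a] multiplies the sum by [th a]. *)
Lemma sum_char_eq0 E a : finite_subfield E -> a \in E -> a != 0 -> th a != 1 ->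
  \sum_(t <- E | t != 0) th t = 0.
Proof.
move=> fE aE a0 ta; apply/eqP.
have : th a * (\sum_(t <- E | t != 0) th t) = \sum_(t <- E | t != 0) th t.
  rewrite -[RHS](sum_fsub_scale fE _ aE a0) mulr_sumr.
  by apply: eq_bigr => t t0; rewrite mult_charM.
move/eqP; rewrite -subr_eq0 -{2}[\sum_(_ <- _ | _) _]mul1r -mulrBl mulf_eq0.
by rewrite subr_eq0 (negbTE ta).
Qed.

Section Orbit.
Variables (V : lmodType kG).
Implicit Types v m : V.

Lemma usumZ E m : usum E *: m = \sum_(x <- E) (upper x ** m).
Proof. by rewrite usum.unlock scaler_suml. Qed.

Lemma lsumZ E m : lsum E *: m = \sum_(t <- E | t != 0) (lower (t ^+ 2) ** m).
Proof. by rewrite lsum.unlock scaler_suml. Qed.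

Lemma scal_nunitsZ E m : scal (nunits E) *: m = \sum_(t <- E | t != 0) m.
Proof.
rewrite /nunits rmorph_sum scaler_suml.
by apply: eq_bigr => t _; rewrite rmorph1 scale1r.
Qed.

Lemma usum_upper E x m : finite_subfield E -> x \in E ->
  usum E *: (upper x ** m) = usum E *: m.
Proof.
move=> fE xE; rewrite scalerA usum.unlock mulr_suml -[in RHS](sum_fsub_shift fE _ xE).
by congr (_ *: _); apply: eq_bigr => y _; rewrite geltM upperD addrC.
Qed.

Lemma averageE E m :
  average E *: m =
  \sum_(t <- E | t != 0) scal (th t)^-1 *: (usum E *: (diag t ** m)).
Proof.
rewrite average.unlock -scalerA scaler_suml scaler_sumr; apply: eq_bigr => t _.
by rewrite -[X in usum E *: X]scalerA scaler_scalC.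
Qed.

Lemma average_upper E x m : finite_subfield E -> x \in E ->
  average E *: (upper x ** m) = average E *: m.
Proof.
move=> fE xE; rewrite !averageE big_seq_cond [RHS]big_seq_cond.
apply: eq_bigr => t /andP[tE t0].
by rewrite geltZ diag_upper // -geltZ usum_upper // !finsubM.
Qed.

Lemma eigenvector_sdot v : eigenvector v ->
  forall a, a != 0 -> diag a ** S ** v = scal (th a)^-1 *: (S ** v).
Proof.
move=> hv a a0; rewrite geltZ diag_sdot // -geltZ hv ?invr_eq0 // mult_charV //.
by rewrite scaler_scalC.
Qed.

Lemma average_eigen E v : eigenvector v ->
  average E *: v = scal (nunits E) *: (usum E *: v).
Proof.
move=> hv; rewrite averageE /nunits rmorph_sum scaler_suml.
apply: eq_bigr => t t0; rewrite hv // scaler_scalC scalZ /=.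
by rewrite mulVf ?mult_char_neq0.
Qed.

Lemma average_sdot E v : eigenvector v ->
  average E *: (S ** v) =
  scal (\sum_(t <- E | t != 0) (th t)^-1 ^+ 2) *: (usum E *: (S ** v)).
Proof.
move=> hv; rewrite averageE rmorph_sum scaler_suml.
apply: eq_bigr => t t0; rewrite eigenvector_sdot // scaler_scalC scalZ /=.
by rewrite expr2.
Qed.

(** Conjugation by h_t turns the parameter r^2 into (r/t)^2, and r/t runs over E^*
    together with t.  Squares appear since the torus acts on unipotent
    parameters through t^2. *)
Lemma average_lower E v r : finite_subfield E -> r \in E -> r != 0 -> eigenvector v ->
  average E *: (lower (r ^+ 2) ** v) = usum E *: (lsum E *: v).
Proof.
move=> fE rE r0 hv; rewrite averageE lsumZ scaler_sumr.
rewrite -[RHS](sum_fsub_div fE _ rE r0); apply: eq_bigr => t t0.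
rewrite geltZ diag_lower // -geltZ hv // 2!scaler_scalC scalZ /=.
by rewrite mulVf ?mult_char_neq0 // rmorph1 scale1r expr_div_n.
Qed.

(** The three Bruhat types average to the three vectors on the right.  The field
    E must contain the unipotent coordinate of each g in the support of a, and
    a square root of its lower unipotent coordinate. *)
Lemma average_orbit v (a : kG) : eigenvector v ->
  eventually (fun E => average E *: (a *: v) =
    scal (pairing borel_coef a * nunits E) *: (usum E *: v)
  + scal (pairing weyl_coef a * \sum_(t <- E | t != 0) (th t)^-1 ^+ 2)
      *: (usum E *: (S ** v))
  + scal (pairing generic_coef a) *: (usum E *: (lsum E *: v))).
Proof.
move=> hv; elim/galg_ind: a => [|a b IHa IHb|c g].
- apply: eventuallyT => E _.
  by rewrite !raddf0 !mul0r !raddf0 !scale0r scaler0 !addr0.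
- apply: eventually_mono (eventually_and IHa IHb) => E _ [aE bE].
  rewrite scalerDl scalerDr aE bE !raddfD /= !mulrDl !raddfD /= !scalerDl.
  by rewrite [in LHS]addrACA; congr (_ + _); rewrite addrACA.
suff: eventually (fun E => average E *: (g ** v) =
    scal (borel_coef g * nunits E) *: (usum E *: v)
  + scal (weyl_coef g * \sum_(t <- E | t != 0) (th t)^-1 ^+ 2)
      *: (usum E *: (S ** v))
  + scal (generic_coef g) *: (usum E *: (lsum E *: v))).
  apply: eventually_mono => E _ gE.
  rewrite -scalerA scaler_scalC gE !pairing_scal !pairing_gelt.
  by rewrite 2!scalerDr !scalZ !mulrA.
rewrite /borel_coef /weyl_coef /generic_coef; have [r0|r0] := eqVneq (val g 1 0) 0.
  have [p0 gE] := borel_decomp r0.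
  have s0 : val g 1 1 != 0.
    by apply/eqP => s0; have [] := coborel_decomp s0; rewrite r0 eqxx.
  rewrite (negbTE s0) /=; apply: eventually_mono (eventually_mem (val g 0 1 / val g 1 1)).
  move=> E fE xE; rewrite [in LHS]gE -geltZ average_upper // hv // scaler_scalC.
  by rewrite average_eigen // mul0r !raddf0 !scale0r !addr0 scalZ.
have [s0|s0] := eqVneq (val g 1 1) 0.
  have [_ q0 gE] := coborel_decomp s0.
  apply: eventually_mono (eventually_mem (- (val g 0 0 * val g 0 1))).
  move=> E fE xE; rewrite [in LHS]gE -geltZ average_upper // -geltZ eigenvector_sdot //.
  rewrite scaler_scalC average_sdot // mul0r /= !raddf0 !scale0r addr0 add0r.
  by rewrite scalZ.
have gE := big_cell_decomp s0.
have [d dE] := closed_sqrt (val g 1 0 * val g 1 1).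
apply: eventually_mono (eventually_and (eventually_mem d)
  (eventually_mem (val g 0 1 / val g 1 1))).
move=> E fE [dinE xE]; rewrite [in LHS]gE -geltZ average_upper // -geltZ hv ?invr_eq0 //.
rewrite 2!scaler_scalC -dE average_lower //; last first.
  apply/eqP => d0; move/eqP: dE.
  by rewrite d0 expr0n eq_sym mulf_eq0 (negbTE r0) (negbTE s0).
by rewrite mult_charV // !mul0r /= !raddf0 !scale0r !add0r.
Qed.

End Orbit.
End Character.
End Averaging.

(** * Relations between averages *)

Section Relations.
Variables (F : closedFieldType) (k : fieldType).
Hypothesis k_char0 : [pchar k] =i pred0.
Hypothesis F_lf : locally_finite F.
Local Notation SL2 := (SL2 F).
Local Notation kG := (galg k SL2).
Local Notation "g ** v" := (gelt k g *: v) (at level 36, right associativity, only parsing).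
Local Notation S := (sdot F).
Implicit Types (E D : seq F) (th : F -> k).
Local Notation usum := (usum k).
Local Notation lsum := (lsum k).
Local Notation nunits := (nunits k).

Lemma natr_char0 n : (n%:R == 0 :> k) = (n == 0)%N.
Proof. by have /pcharf0P -> := k_char0. Qed.

Lemma sum_natr1 E : \sum_(x <- E) 1 = (size E)%:R :> k.
Proof. by rewrite -sum1_size natr_sum. Qed.

Lemma nunitsE E : finite_subfield E -> nunits E = (size E).-1%:R.
Proof.
move=> fE; apply: (addrI 1); rewrite -(sum_split0 fE) sum_natr1 nat1r.
by rewrite prednK //; have := finsub1 fE; case: (E).
Qed.

Lemma nunits_neq0 E : finite_subfield E -> nunits E != 0.
Proof.
move=> fE; rewrite nunitsE // natr_char0 -lt0n -ltnS prednK; last first.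
  by have := finsub1 fE; case: (E).
apply: (@uniq_leq_size _ [:: 0 : F; 1]).
  by rewrite /= inE eq_sym oner_eq0.
by move=> x; rewrite !inE => /orP[]/eqP ->; [exact: finsub0 | exact: finsub1].
Qed.

Lemma larger_subfield (l : seq F) D : exists E,
  [/\ finite_subfield E, {subset l <= E}, {subset D <= E} &
      finite_subfield D -> nunits E - nunits D != 0].
Proof.
have [z zD] := closed_infinite D; have [E fE lE] := F_lf (z :: l ++ D).
have DE : {subset D <= E} by move=> x xD; apply: lE; rewrite inE mem_cat xD !orbT.
exists E; split=> // [x xl|fD].
  by apply: lE; rewrite inE mem_cat xl orbT.
have lt : (size D < size E)%N.
  have := @uniq_leq_size _ (z :: D) E; apply; first by rewrite /= zD finsub_uniq.
  by move=> x; rewrite inE => /predU1P[->|/DE //]; apply: lE; rewrite mem_head.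
have D0 : (0 < size D)%N by have := finsub1 fD; case: (D).
rewrite !nunitsE // -natrB ?natr_char0 ?subn_eq0.
  by rewrite -ltnNge -ltnS !prednK // (leq_ltn_trans _ lt).
by rewrite -ltnS !prednK // ?(ltnW lt) // (leq_ltn_trans _ lt).
Qed.

Lemma eventually_ex (P : seq F -> Prop) : eventually P ->
  exists2 E, finite_subfield E & P E.
Proof. by move=> [l lP]; have [E fE lE] := F_lf l; exists E => //; apply: lP. Qed.

Section Module.
Variable V : lmodType kG.
Implicit Type v : V.

(** For t in E^*, conjugating [U_D v = 0] by h_r with r^2 = t gives
    sum_(x in D) u_(t x) v = 0.  In the sum over t, the term x = 0 contributes
    (#E - 1) v, and each nonzero x contributes the sum of all u_y v with y in
    E^*, that is [U_E v - v].  Since E is a union of cosets of D, [U_E v = 0],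
    and (#E - #D) v = 0 remains. *)
Lemma usum_eq0 th v D : mult_char th -> eigenvector th v -> finite_subfield D ->
  usum D *: v = 0 -> v = 0.
Proof.
move=> thP hv fD Dv; have [E [fE _ DE /(_ fD) nED]] := larger_subfield [::] D.
have tD t : t != 0 -> \sum_(x <- D) (upper (t * x) ** v) = 0.
  move=> t0; have [r rt] := closed_sqrt t.
  have r0 : r != 0.
    by apply/eqP => r0; move/eqP: rt; rewrite r0 expr0n eq_sym (negbTE t0).
  apply: (scal_eq0 (c := th r)); last exact: (mult_char_neq0 thP).
  transitivity (diag r ** (usum D *: v)); last by rewrite Dv scaler0.
  rewrite usumZ !scaler_sumr; apply: eq_bigr => x _.
  by rewrite geltZ diag_upper // rt -geltZ hv // scaler_scalC.
have Ev : usum E *: v = 0.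
  apply: (scal_eq0 (c := (size D)%:R)); last first.
    by rewrite natr_char0; have := finsub1 fD; case: (D).
  rewrite -sum_natr1 rmorph_sum scaler_suml.
  transitivity (usum E *: (usum D *: v)); last by rewrite Dv scaler0.
  rewrite (usumZ D) scaler_sumr.
  rewrite big_seq [RHS]big_seq; apply: eq_bigr => x xD.
  by rewrite usum_upper ?rmorph1 ?scale1r //; apply: DE.
have EvN : \sum_(x <- E | x != 0) (upper x ** v) = - v.
  apply/eqP; rewrite -addr_eq0 addrC; apply/eqP.
  transitivity (usum E *: v); last by [].
  rewrite usumZ (sum_split0 fE (fun x => upper x ** v)).
  by rewrite upper0 gelt1Z.
have: \sum_(t <- E | t != 0) \sum_(x <- D) (upper (t * x) ** v) = 0.
  by rewrite big1 // => t; apply: tD.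
rewrite exchange_big /= (sum_split0 fD) /=.
under eq_bigr do rewrite mulr0 upper0 gelt1Z.
have -> : \sum_(x <- D | x != 0) \sum_(t <- E | t != 0) (upper (t * x) ** v) =
          \sum_(x <- D | x != 0) - v.
  rewrite big_seq_cond [RHS]big_seq_cond; apply: eq_bigr => x /andP[xD x0].
  rewrite -EvN -[RHS](sum_fsub_scale fE _ (DE _ xD) x0).
  by apply: eq_bigr => t _; rewrite mulrC.
move=> e; apply: (scal_eq0 _ nED).
by rewrite rmorphB scalerBl !scal_nunitsZ -sumrN.
Qed.

Definition big_cell_relation (al be : k) v E :=
  scal (al * nunits E) *: (usum E *: v) + scal be *: (usum E *: (lsum E *: v)) = 0.

(** Packages the relation as an annihilator of v, which can then be conjugated
    by s. *)
Definition relator (al be : k) E : kG :=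
  usum E * (scal (al * nunits E) + scal be * lsum E).

Lemma relator_eq0 al be v E : big_cell_relation al be v E -> relator al be E *: v = 0.
Proof.
move=> <-; rewrite -scalerA scalerDl scalerDr -[(scal be * _) *: _]scalerA.
by rewrite !scaler_scalC.
Qed.

Lemma annihilator_average th v a : mult_char th -> eigenvector th v -> a *: v = 0 ->
  eventually (fun E =>
    scal (pairing (borel_coef th) a * nunits E) *: (usum E *: v)
  + scal (pairing (weyl_coef th) a * \sum_(t <- E | t != 0) (th t)^-1 ^+ 2)
      *: (usum E *: (S ** v))
  + scal (pairing (generic_coef th) a) *: (usum E *: (lsum E *: v)) = 0).
Proof.
move=> thP hv av; apply: eventually_mono (average_orbit thP a hv) => E _ <-.
by rewrite av scaler0.
Qed.

End Module.

Lemma pairing_conj_relator (f : SL2 -> k) al be D :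
  pairing f (gelt k S^-1%g * relator al be D * gelt k S) =
  al * nunits D * \sum_(x <- D) f (S^-1 * upper x * S)%g
  + be * \sum_(t <- D | t != 0) \sum_(x <- D) f (S^-1 * (upper x * lower (t ^+ 2)) * S)%g.
Proof.
rewrite /relator pairing_sandwich; congr (_ * _ + _ * _).
  rewrite usum.unlock mulr_sumr mulr_suml raddf_sum; apply: eq_bigr => x _.
  by rewrite /= !geltM pairing_gelt.
rewrite lsum.unlock [usum D * _]mulr_sumr [gelt k _ * _]mulr_sumr mulr_suml raddf_sum.
apply: eq_bigr => t _; rewrite usum.unlock [(\sum_(x <- D) _) * _]mulr_suml.
rewrite [gelt k _ * _]mulr_sumr [_ * gelt k S]mulr_suml raddf_sum.
by apply: eq_bigr => x _; rewrite /= !geltM pairing_gelt.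
Qed.

Lemma conj_upperE x : let g := (S^-1 * upper x * S)%g in
  ((val g 0 0 = 1) * (val g 1 0 = - x) * (val g 1 1 = 1))%type.
Proof. by move=> g; rewrite /g !entryE; split; [split|]; ring. Qed.

Lemma conj_upper_lowerE x y : let g := (S^-1 * (upper x * lower y) * S)%g in
  ((val g 0 0 = 1) * (val g 0 1 = - y) *
   (val g 1 0 = - x) * (val g 1 1 = (1 + x * y)%R))%type.
Proof. by move=> g; rewrite /g !entryE; split; [split; [split|]|]; ring. Qed.

Section Cells.
Variables (th : F -> k) (thP : mult_char th) (al be : k).
Variables (D : seq F) (fD : finite_subfield D).

Lemma borel_coef_relator :
  pairing (borel_coef th) (gelt k S^-1%g * relator al be D * gelt k S) =
  nunits D * (al + be).
Proof.
have one (c : k) : \sum_(x <- D) (if - x == 0 then c else 0) = c.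
  rewrite (sum_split0 fD) oppr0 eqxx big1 ?addr0 // => x x0.
  by rewrite oppr_eq0 (negbTE x0).
rewrite pairing_conj_relator /borel_coef.
under eq_bigr do rewrite !conj_upperE.
under [in X in _ + X]eq_bigr do under eq_bigr do rewrite !conj_upper_lowerE.
rewrite one (mult_char1 thP) mulr1.
by rewrite -/(nunits D); ring.
Qed.

(** Here x |-> 1 + x t^2 is a bijection of D: the scalar 1 + x t^2 is the entry
    that governs the Bruhat type of s^-1 u_x l_(t^2) s. *)
Lemma sum_affine (f : F -> k) t : t \in D -> t != 0 ->
  \sum_(x <- D) f (1 + x * t ^+ 2) = \sum_(x <- D) f x.
Proof.
move=> tD t0; have t2 : t ^+ 2 \in D by rewrite expr2 finsubM.
have t20 : t ^+ 2 != 0 by rewrite expf_eq0.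
transitivity (\sum_(x <- D) f (1 + x)); last exact: (sum_fsub_shift fD _ (finsub1 fD)).
rewrite [LHS](sum_split0 fD) [RHS](sum_split0 fD) mul0r; congr (_ + _).
rewrite -[RHS](sum_fsub_scale fD _ t2 t20).
by apply: eq_bigr => x _; rewrite mulrC.
Qed.

Lemma generic_coef_relator :
  pairing (generic_coef th) (gelt k S^-1%g * relator al be D * gelt k S) =
  nunits D * (al * nunits D + be * (\sum_(t <- D | t != 0) (th t)^-1 - 1)).
Proof.
rewrite pairing_conj_relator /generic_coef.
under eq_bigr do rewrite !conj_upperE oppr_eq0 oner_eq0 andbT (mult_char1 thP) invr1.
rewrite -big_mkcond /= -/(nunits D).
have -> : \sum_(t <- D | t != 0) \sum_(x <- D)
    (if (val (S^-1 * (upper x * lower (t ^+ 2)) * S)%g 1 0 != 0) &&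
        (val (S^-1 * (upper x * lower (t ^+ 2)) * S)%g 1 1 != 0)
     then (th (val (S^-1 * (upper x * lower (t ^+ 2)) * S)%g 1 1))^-1 else 0)
  = \sum_(t <- D | t != 0) (\sum_(t <- D | t != 0) (th t)^-1 - 1).
  rewrite big_seq_cond [RHS]big_seq_cond; apply: eq_bigr => t /andP[tD t0].
  pose f (y : F) : k := if (y != 1) && (y != 0) then (th y)^-1 else 0.
  transitivity (\sum_(x <- D) f (1 + x * t ^+ 2)).
    apply: eq_bigr => x _; rewrite !conj_upper_lowerE /f oppr_eq0.
    rewrite -[in RHS](inj_eq (addrI (-1))) addKr addNr mulf_eq0 expf_eq0.
    by rewrite (negbTE t0) orbF.
  rewrite sum_affine // /f -big_mkcond /=.
  rewrite [in RHS]big_mkcond (bigD1_seq 1) ?finsub1 ?finsub_uniq //= oner_neq0.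
  by rewrite (mult_char1 thP) invr1 [RHS]addrC addKr -big_mkcondr.
have -> c : \sum_(t <- D | t != 0) c = nunits D * c.
  by rewrite /nunits mulr_suml; apply: eq_bigr => t _; rewrite mul1r.
by ring.
Qed.

End Cells.
End Relations.

(** * Vanishing theorems *)

Section Vanishing.
Variables (F : closedFieldType) (k : fieldType).
Hypothesis k_char0 : [pchar k] =i pred0.
Hypothesis F_lf : locally_finite F.
Local Notation SL2 := (SL2 F).
Local Notation kG := (galg k SL2).
Local Notation "g ** v" := (gelt k g *: v) (at level 36, right associativity, only parsing).
Local Notation S := (sdot F).
Implicit Types (E D : seq F) (th : F -> k).
Local Notation usum := (usum k).
Local Notation lsum := (lsum k).
Local Notation nunits := (nunits k).

Definition nontrivial th := exists2 a, a != 0 & th a != 1.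

Definition trivial_char : F -> k := fun=> 1.

Lemma trivial_mult_char : mult_char trivial_char.
Proof. by split=> *; rewrite /trivial_char ?mulr1 ?oner_neq0. Qed.

Lemma inv_mult_char th : mult_char th -> mult_char (fun t => (th t)^-1).
Proof.
move=> thP; split=> [a b a0 b0|a a0]; first by rewrite (mult_charM thP) // invfM.
by rewrite invr_eq0 (mult_char_neq0 thP).
Qed.

Lemma nontrivialV th : nontrivial th -> nontrivial (fun t => (th t)^-1).
Proof. by case=> a a0 ta; exists a => //; rewrite invr_eq1. Qed.

(** F^* is divisible by 2. *)
Lemma nontrivial_sqr th : mult_char th -> nontrivial th ->
  exists2 a, a != 0 & th a ^+ 2 != 1.
Proof.
move=> thP [a a0 ta]; have [r ra] := closed_sqrt a.
have r0 : r != 0.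
  by apply/eqP => r0; move/eqP: ra; rewrite r0 expr0n eq_sym (negbTE a0).
by exists r => //; rewrite expr2 -(mult_charM thP) // -expr2 ra.
Qed.

Lemma sum_sqr_char_eq0 th : mult_char th -> nontrivial th ->
  eventually (fun E => \sum_(t <- E | t != 0) th t ^+ 2 = 0).
Proof.
move=> thP /(nontrivial_sqr thP)[a a0 ta].
apply: eventually_mono (eventually_mem a) => E fE aE.
apply: (sum_char_eq0 (th := fun t => th t ^+ 2)) fE aE a0 ta.
split=> [x y x0 y0|x x0]; first by rewrite (mult_charM thP) // exprMn.
by rewrite expf_eq0 (mult_char_neq0 thP).
Qed.

Lemma weyl_coef_relator_trivial al be D : finite_subfield D ->
  pairing (weyl_coef trivial_char) (gelt k S^-1%g * relator al be D * gelt k S) =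
  nunits D * be.
Proof.
move=> fD; rewrite pairing_conj_relator /weyl_coef /trivial_char.
under eq_bigr do rewrite !conj_upperE oner_eq0.
rewrite big1 // mulr0 add0r.
rewrite [nunits D * be]mulrC; congr (_ * _).
rewrite /nunits big_seq_cond [RHS]big_seq_cond; apply: eq_bigr => t /andP[tD t0].
under eq_bigr do rewrite !conj_upper_lowerE.
rewrite (sum_affine fD (fun y => if y == 0 then 1^-1 else 0) tD t0).
rewrite (sum_split0 fD) eqxx invr1 big1 ?addr0 // => x x0.
by rewrite (negbTE x0).
Qed.

Section Module.
Variable V : lmodType kG.
Implicit Types v X Y : V.

(** Both equations have the same coefficient of X once m1 and m2 are cancelled,
    so their difference isolates Y. *)
Lemma eliminate (m1 m2 p q1 q2 : k) X Y : m1 != 0 -> m2 != 0 -> q1 - q2 != 0 ->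
  scal (m1 * p) *: X + scal (m1 * q1) *: Y = 0 ->
  scal (m2 * p) *: X + scal (m2 * q2) *: Y = 0 -> Y = 0.
Proof.
have cancel m q : m != 0 -> scal (m * p) *: X + scal (m * q) *: Y = 0 ->
    scal q *: Y = - (scal p *: X).
  move=> m0; rewrite -!scalZ -scalerDr => /scal_eq0 /(_ m0) /eqP.
  by rewrite addrC addr_eq0 => /eqP.
move=> m10 m20 q0 /(cancel _ _ m10) e1 /(cancel _ _ m20) e2.
by apply: (scal_eq0 _ q0); rewrite rmorphB scalerBl e1 e2 subrr.
Qed.

Lemma conj_relator_eq0 al be v v' D : v = S ** v' -> big_cell_relation al be v D ->
  (gelt k S^-1%g * relator al be D * gelt k S) *: v' = 0.
Proof.
by move=> vE rel; rewrite -2!scalerA -vE (relator_eq0 rel) scaler0.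
Qed.

Section Nontrivial.
Variables (th : F -> k) (thP : mult_char th) (th_nt : nontrivial th).

Lemma annihilator_relation v a : eigenvector th v -> a *: v = 0 ->
  eventually
    (big_cell_relation (pairing (borel_coef th) a) (pairing (generic_coef th) a) v).
Proof.
move=> hv av.
apply: eventually_mono (eventually_and (annihilator_average thP hv av)
  (sum_sqr_char_eq0 (inv_mult_char thP) (nontrivialV th_nt))) => E _ [+ s0].
by rewrite s0 mulr0 raddf0 scale0r addr0.
Qed.

End Nontrivial.

(** The relation over D, conjugated by s, annihilates v' = s^-1 v, which has
    eigencharacter th^-1.  Its average over a larger E has coefficients
    (#D - 1)(al + be) and (#D - 1)(al (#D - 1) - be): the last one comes from
    the sum of th over D^*, which is zero, minus its term th 1.  After division by
    #D - 1 only the second coefficient varies with D, with slope al, so two fields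
    of different sizes give [U_E L_E v' = 0]. *)
Lemma lsum_opposite_eq0 th v v' a : mult_char th -> nontrivial th ->
  eigenvector th v -> eigenvector (fun t => (th t)^-1) v' -> v = S ** v' ->
  a *: v = 0 -> pairing (borel_coef th) a != 0 ->
  eventually (fun E => usum E *: (lsum E *: v') = 0).
Proof.
move=> thP th_nt hv hv' vE av al0.
set al := pairing _ a in al0; set be := pairing (generic_coef th) a.
pose th' t := (th t)^-1; have th'P : mult_char th' := inv_mult_char thP.
have [l lP] := annihilator_relation thP th_nt hv av.
have [a0 a00 ta0] := th_nt.
have rel D : finite_subfield D -> {subset a0 :: l <= D} ->
    eventually (big_cell_relation (nunits D * (al + be))
                  (nunits D * (al * nunits D - be)) v').
  move=> fD lD; have lD' : {subset l <= D} by move=> x xl; apply: lD; rewrite inE xl orbT.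
  have relD := lP _ fD lD'.
  have := annihilator_relation th'P (nontrivialV th_nt) hv' (conj_relator_eq0 vE relD).
  rewrite borel_coef_relator // generic_coef_relator //.
  have -> : \sum_(t <- D | t != 0) (th' t)^-1 = 0.
    under eq_bigr do rewrite /th' invrK.
    by apply: (sum_char_eq0 thP fD _ a00 ta0); apply: lD; rewrite mem_head.
  by rewrite sub0r mulrN1.
have [D1 [fD1 lD1 _ _]] := larger_subfield k_char0 F_lf (a0 :: l) [::].
have [D2 [fD2 lD2 _ /(_ fD1) nD]] := larger_subfield k_char0 F_lf (a0 :: l) D1.
apply: eventually_mono (eventually_and (rel _ fD1 lD1) (rel _ fD2 lD2)) => E fE [r1 r2].
move: r1 r2; rewrite /big_cell_relation -!mulrA => r1 r2.
apply: (eliminate (nunits_neq0 k_char0 fD2) (nunits_neq0 k_char0 fD1) _ r2 r1).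
have -> : al * nunits D2 - be - (al * nunits D1 - be) = al * (nunits D2 - nunits D1).
  by ring.
exact: mulf_neq0.
Qed.

(** The relation for v removes [U_E L_E v'], so that the average of the relation
    for v' is a nonzero multiple of [U_E v']. *)
Theorem torus_vanishing th v v' a b : mult_char th -> nontrivial th ->
  eigenvector th v -> eigenvector (fun t => (th t)^-1) v' -> v = S ** v' ->
  a *: v = 0 -> pairing (borel_coef th) a != 0 ->
  b *: v' = 0 -> pairing (borel_coef (fun t => (th t)^-1)) b != 0 -> v = 0.
Proof.
move=> thP th_nt hv hv' vE av al0 bv' al'0.
pose th' t := (th t)^-1; have th'P : mult_char th' := inv_mult_char thP.
have h := eventually_and (lsum_opposite_eq0 thP th_nt hv hv' vE av al0)
  (annihilator_relation th'P (nontrivialV th_nt) hv' bv').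
have [E fE [Y0 rel]] := eventually_ex F_lf h.
rewrite vE (_ : v' = 0) ?scaler0 //.
apply: (usum_eq0 k_char0 F_lf th'P hv' fE).
move: rel; rewrite /big_cell_relation Y0 scaler0 addr0 => /scal_eq0; apply.
by rewrite mulf_neq0 // nunits_neq0.
Qed.

(** For a U-fixed v, the vector l_y v is, up to U, the multiple th(-y) of s v;
    so [U_E L_E v] contains the sum of th^2 over E^*, which is zero. *)
Theorem borel_vanishing th v a : mult_char th -> nontrivial th ->
  eigenvector th v -> (forall x, upper x ** v = v) ->
  a *: v = 0 -> pairing (borel_coef th) a != 0 -> v = 0.
Proof.
move=> thP th_nt hv uv av al0.
have h := eventually_and (sum_sqr_char_eq0 thP th_nt)
  (annihilator_relation thP th_nt hv av).
have [E fE [s0 rel]] := eventually_ex F_lf h.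
have flip t : t != 0 -> lower t ** v = upper t^-1 ** (diag (- t^-1) ** (S ** v)).
  move=> t0; rewrite -[in LHS](uv (- t^-1)) !geltZ; congr (gelt k _ *: v).
  have nt0 : - t^-1 != 0 by rewrite oppr_eq0 invr_eq0.
  by apply: SL2P; rewrite !(entryE, diagE nt0); field; rewrite t0 oppr_eq0 oner_neq0.
have Y0 : usum E *: (lsum E *: v) = 0.
  rewrite lsumZ scaler_sumr big_seq_cond.
  rewrite (eq_bigr (fun t => scal (th (-1) * th t ^+ 2) *: (usum E *: (S ** v))));
    last first.
    move=> t /andP[tE t0]; have t20 : t ^+ 2 != 0 by rewrite expf_eq0.
    have m10 : -1 != 0 :> F by rewrite oppr_eq0 oner_eq0.
    have n0 : - (t ^+ 2)^-1 != 0 by rewrite oppr_eq0 invr_eq0.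
    rewrite flip // usum_upper //; last by rewrite finsubV // expr2 finsubM.
    rewrite (eigenvector_sdot thP hv) // scaler_scalC -(mult_charV thP) // invrN invrK.
    congr (scal _ *: _); rewrite -(mulN1r (t ^+ 2)) (mult_charM thP) //.
    by rewrite !expr2 (mult_charM thP).
  rewrite -big_seq_cond -scaler_suml -[RHS](scale0r (usum E *: (S ** v))).
  by congr (_ *: _); rewrite -rmorph_sum -mulr_sumr s0 mulr0 rmorph0.
apply: (usum_eq0 k_char0 F_lf thP hv fE).
move: rel; rewrite /big_cell_relation Y0 scaler0 addr0 => /scal_eq0; apply.
by rewrite mulf_neq0 // nunits_neq0.
Qed.

Lemma trivial_relation v a (e : k) : eigenvector trivial_char v ->
  S ** v = scal e *: v -> a *: v = 0 ->
  eventually (big_cell_relation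
    (pairing (borel_coef trivial_char) a + e * pairing (weyl_coef trivial_char) a)
    (pairing (generic_coef trivial_char) a) v).
Proof.
move=> hv Sv av.
apply: eventually_mono (annihilator_average trivial_mult_char hv av) => E _.
rewrite Sv [usum E *: (scal e *: v)]scaler_scalC scalZ -scalerDl -rmorphD.
have -> : \sum_(t <- E | t != 0) (trivial_char t)^-1 ^+ 2 = nunits E.
  by apply: eq_bigr => t _; rewrite /trivial_char invr1 expr1n.
by rewrite /big_cell_relation mulrDl [_ * e]mulrC mulrA.
Qed.

(** Here the torus acts trivially and s v = v, so conjugating by s gives back a
    relation for v itself.  After division by #D - 1, its second coefficient
    is affine in #D with slope al + be, the augmentation of a, which gives
    [U_E L_E v = 0]; then [al U_E v = 0] and [(al + 2 be) U_E v = 0]. *)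
Theorem plus_vanishing v a : eigenvector trivial_char v -> S ** v = v ->
  a *: v = 0 -> pairing (fun=> 1) a != 0 -> v = 0.
Proof.
move=> hv Sv av aug.
have Sv1 : S ** v = scal 1 *: v by rewrite rmorph1 scale1r.
pose al := pairing (borel_coef trivial_char) a + 1 * pairing (weyl_coef trivial_char) a.
pose be := pairing (generic_coef trivial_char) a.
have augE : al + be != 0.
  apply: contra_neq aug => <-; rewrite /al /be mul1r -!pairingDf.
  apply: eq_pairing => g; rewrite /borel_coef /weyl_coef /generic_coef /trivial_char invr1.
  have [r0|r0] := eqVneq (val g 1 0) 0; have [s0|s0] := eqVneq (val g 1 1) 0;
    rewrite ?addr0 ?add0r //.
  by have [] := coborel_decomp s0; rewrite r0 eqxx.
have [l lP] := trivial_relation hv Sv1 av.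
have rel D : finite_subfield D -> {subset l <= D} ->
    eventually (big_cell_relation (nunits D * (al + be + be))
                  (nunits D * (al * nunits D + be * (nunits D - 1))) v).
  move=> fD /(lP _ fD) relD.
  have := trivial_relation hv Sv1 (conj_relator_eq0 (esym Sv) relD).
  rewrite borel_coef_relator ?generic_coef_relator ?weyl_coef_relator_trivial //;
    try exact: trivial_mult_char.
  have -> : \sum_(t <- D | t != 0) (trivial_char t)^-1 = nunits D.
    by apply: eq_bigr => t _; rewrite /trivial_char invr1.
  by rewrite -/al -/be [1 * (_ * be)]mul1r -mulrDr.
have [D1 [fD1 lD1 _ _]] := larger_subfield k_char0 F_lf l [::].
have [D2 [fD2 lD2 _ /(_ fD1) nD]] := larger_subfield k_char0 F_lf l D1.
have h := eventually_and (eventually_sub l)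
  (eventually_and (rel _ fD1 lD1) (rel _ fD2 lD2)).
have [E fE [/(lP _ fE) rE [r1 r2]]] := eventually_ex F_lf h.
have Y0 : usum E *: (lsum E *: v) = 0.
  move: r1 r2; rewrite /big_cell_relation -!mulrA => r1 r2.
  apply: (eliminate (nunits_neq0 k_char0 fD2) (nunits_neq0 k_char0 fD1) _ r2 r1).
  set x := al * _ + _ - _.
  have -> : x = (al + be) * (nunits D2 - nunits D1) by rewrite /x; ring.
  exact: mulf_neq0.
apply: (usum_eq0 k_char0 F_lf trivial_mult_char hv fE).
have [al0|al0] := eqVneq al 0; last first.
  move: rE; rewrite /big_cell_relation Y0 scaler0 addr0 => /scal_eq0; apply.
  by rewrite mulf_neq0 // nunits_neq0.
move: r1; rewrite /big_cell_relation Y0 scaler0 addr0 => /scal_eq0; apply.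
rewrite !mulf_neq0 ?nunits_neq0 // al0 add0r -mulr2n -mulr_natr mulf_neq0 //.
  by move: augE; rewrite al0 add0r.
by rewrite natr_char0.
Qed.

(** The vector l_y v corresponds to the ordered pair of points (1/y, 0), and
    s v = - v means that exchanging the two points changes the sign.  Up to
    translation by U the exchanged pair is the one of parameter -y.  As -1 is a
    square in a large E, [U_E L_E v] equals its opposite. *)
Theorem minus_vanishing v a : eigenvector trivial_char v -> S ** v = - v ->
  a *: v = 0 ->
  pairing (borel_coef trivial_char) a - pairing (weyl_coef trivial_char) a != 0 -> v = 0.
Proof.
move=> hv Sv av al0.
have SvN : S ** v = scal (-1) *: v by rewrite rmorphN1 scaleN1r.
have [i i2] := closed_sqrt (-1 : F).
have i0 : i != 0.
  by apply/eqP => i0; move/eqP: i2; rewrite i0 expr0n eq_sym oppr_eq0 oner_eq0.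
have h := eventually_and (eventually_mem i) (trivial_relation hv SvN av).
have [E fE [iE rel]] := eventually_ex F_lf h.
have flip t : t != 0 -> lower t ** v = - (upper t^-1 ** (lower (- t) ** v)).
  move=> t0; have tV0 : t^-1 != 0 by rewrite invr_eq0.
  rewrite -[in LHS](opprK v) -Sv scalerN; congr (- _).
  have -> : lower (- t) ** v = lower (- t) ** (diag t^-1 ** v).
    by rewrite hv // rmorph1 scale1r.
  rewrite !geltZ; congr (gelt k _ *: v).
  by apply: SL2P; rewrite !(entryE, diagE tV0); field; rewrite ?t0 ?oner_neq0.
have Y0 : usum E *: (lsum E *: v) = 0.
  have YN : usum E *: (lsum E *: v) = - (usum E *: (lsum E *: v)).
    rewrite !lsumZ !scaler_sumr -[in RHS](sum_fsub_scale fE _ iE i0) -sumrN.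
    rewrite big_seq_cond [RHS]big_seq_cond; apply: eq_bigr => t /andP[tE t0].
    have t20 : t ^+ 2 != 0 by rewrite expf_eq0.
    rewrite flip // scalerN usum_upper ?finsubV ?finsubM ?expr2 // -!expr2.
    by rewrite exprMn i2 mulN1r.
  apply: (scal_eq0 (c := 2)); last by rewrite natr_char0.
  by rewrite rmorph_nat scaler_nat mulr2n {1}YN addNr.
apply: (usum_eq0 k_char0 F_lf trivial_mult_char hv fE).
move: rel; rewrite /big_cell_relation Y0 scaler0 addr0 mulN1r => /scal_eq0; apply.
by rewrite mulf_neq0 // nunits_neq0.
Qed.

End Module.
End Vanishing.

(** * Maximal submodules as kernels *)

Section Kernels.
Variables (R : nzRingType) (M N : lmodType R) (f : {linear M -> N}).

Definition ker_pred : {pred M} := fun m => f m == 0.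
Lemma ker_pred_closed : submod_closed ker_pred.
Proof.
split=> [|a x y]; first by rewrite -[_ \in _]/(f 0 == 0) raddf0.
rewrite -[_ \in _]/(f x == 0) -[y \in _]/(f y == 0) -[_ \in _]/(f _ == 0).
by move=> /eqP fx /eqP fy; rewrite linearP fx fy scaler0 addr0.
Qed.
HB.instance Definition _ := GRing.isSubmodClosed.Build R M ker_pred ker_pred_closed.
Definition ker : submodClosed M := ker_pred.

Lemma kerE m : (m \in ker) = (f m == 0). Proof. by []. Qed.

Variable w : M.
Hypothesis w_gen : forall m, exists a, m = a *: w.
Hypothesis fw : f w != 0.

Lemma gen_mem (Y : submodClosed M) : w \in Y -> Y =i predT.
Proof. by move=> wY m; have [a ->] := w_gen m; rewrite rpredZ. Qed.

Lemma ker_maximal :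
  (forall Y : submodClosed M, {subset ker <= Y} ->
     forall m, m \in Y -> f m != 0 -> w \in Y) -> maximal_submod ker.
Proof.
move=> h; split=> [|Y kY]; first by exists w.
have [[m mY fm]|YX] := pselect (exists2 m, m \in Y & f m != 0).
  by right; apply/gen_mem/(h Y kY m).
left=> m; apply/idP/idP => [mY|/kY //].
by rewrite kerE; apply/negPn/negP => fm; apply: YX; exists m.
Qed.

Lemma maximal_sub_ker (Y : submodClosed M) : maximal_submod Y ->
  ~ (exists2 m, m \in Y & f m != 0) -> Y =i ker.
Proof.
move=> [_ maxY] YX; have sub : {subset Y <= ker}.
  by move=> m mY; rewrite kerE; apply/negPn/negP => fm; apply: YX; exists m.
have [h m|h] := maxY _ sub; first by rewrite h.
by move: fw; rewrite -kerE h.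
Qed.

End Kernels.

Lemma ker_eqP (R : nzRingType) (M N1 N2 : lmodType R)
    (f1 : {linear M -> N1}) (f2 : {linear M -> N2}) :
  ker f1 =i ker f2 -> forall m, f1 m = 0 <-> f2 m = 0.
Proof.
move=> e m; have := e m; rewrite !kerE => {}e.
by split=> /eqP h; apply/eqP; rewrite -?e // e.
Qed.

(** Both modules are the quotient of M by the common kernel. *)
Lemma same_kernel_iso (R : nzRingType) (M N1 N2 : lmodType R)
    (f1 : {linear M -> N1}) (f2 : {linear M -> N2}) :
  (forall n, exists m, f1 m = n) -> (forall n, exists m, f2 m = n) ->
  (forall m, f1 m = 0 <-> f2 m = 0) -> mod_iso N1 N2.
Proof.
move=> s1 s2 ker12; pose h n := f2 (projT1 (cid (s1 n))).
have hE m : h (f1 m) = f2 m.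
  rewrite /h; case: cid => m' /= e; apply/eqP; rewrite -subr_eq0 -raddfB.
  by apply/eqP/ker12; rewrite raddfB /= e subrr.
have hB : zmod_morphism h.
  by move=> x y; have [m <-] := s1 x; have [n <-] := s1 y; rewrite -raddfB !hE raddfB.
have hZ : scalable h.
  by move=> a x; have [m <-] := s1 x; rewrite -linearZ !hE linearZ.
pose hA := GRing.isZmodMorphism.Build N1 N2 h hB.
pose hS := GRing.isScalable.Build R N1 N2 *:%R h hZ.
pose hL : {linear N1 -> N2} := HB.pack h hA hS.
exists hL; exists (fun n => f1 (projT1 (cid (s2 n)))) => x.
  have [m <-] := s1 x; rewrite -[hL _]/(h _) hE; case: cid => m' /= e.
  apply/eqP; rewrite -subr_eq0 -raddfB; apply/eqP/ker12.
  by rewrite raddfB /= e subrr.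
by rewrite -[LHS]/(h _) hE; case: cid => m' /=.
Qed.

Lemma sub_mod_valZ (R : nzRingType) (M : lmodType R) (X : submodClosed M) a
  (x : sub_mod X) : val (a *: x) = a *: val x.
Proof. by rewrite linearZ. Qed.

Lemma quot_proj_eq0 (R : nzRingType) (M : lmodType R) (X : submodClosed M) x :
  quot_proj X x = 0 <-> x \in X.
Proof. by rewrite -(raddf0 (quot_proj X)) quot_projP subr0. Qed.

Lemma quot_ker_iso (R : nzRingType) (M N : lmodType R) (f : {linear M -> N}) :
  (forall n, exists m, f m = n) -> mod_iso (quot_mod (ker f)) N.
Proof.
move=> sf; apply: (same_kernel_iso (quot_proj_surj (X := ker f)) sf) => m.
by rewrite quot_proj_eq0 kerE; split=> /eqP.
Qed.

Lemma largest_kernel (R : nzRingType) (M N : lmodType R) (f : {linear M -> N}) (w : M) :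
  (forall m, exists a, m = a *: w) -> f w != 0 -> (forall n, exists m, f m = n) ->
  (forall (Y : submodClosed M) m, m \in Y -> f m != 0 -> w \in Y) ->
  exists X : submodClosed M,
    [/\ maximal_submod X, forall Y : submodClosed M, maximal_submod Y -> Y =i X,
        simple_mod (quot_mod X) & mod_iso (quot_mod X) N].
Proof.
move=> w_gen fw f_surj h; exists (ker f).
have kmax : maximal_submod (ker f) by apply: (ker_maximal w_gen fw) => Y _; apply: h.
split=> //; last exact: quot_ker_iso.
  move=> Y maxY; apply: (maximal_sub_ker fw) => // -[m mY fm].
  have [[x xY] _] := maxY; move: xY.
  by rewrite (gen_mem w_gen (h Y m mY fm)).
exact/simple_quotP.
Qed.

(** * Characters of the torus and principal series *)

Section TorusCharacters.
Variables (F : closedFieldType) (k : fieldType).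
Local Notation SL2 := (SL2 F).
Local Notation kG := (galg k SL2).
Local Notation "g ** v" := (gelt k g *: v) (at level 36, right associativity, only parsing).
Local Notation S := (sdot F).
Local Notation T := (torus_group F).
Local Notation B := (borel_group F).
Local Notation N := (ntorus_group F).
Implicit Types (theta : {multiplicative T -> Gm k}) (a b x : F).

Lemma diag_torus a : a != 0 -> diag a \in @torus F.
Proof. by move=> a0; apply/torusP; rewrite !diagE. Qed.

Lemma torus_dg (A : SL2) : A \in @torus F -> val A 0 0 != 0 /\ A = diag (val A 0 0).
Proof.
move=> /torusP[A01 A10]; have := SL2_detE A; rewrite A01 mul0r subr0 => d.
have A00 : val A 0 0 != 0.
  by apply/eqP => e; move/eqP: d; rewrite e mul0r eq_sym oner_eq0.
split=> //; apply: SL2P; rewrite !(diagE A00) //.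
by apply: (mulfI A00); rewrite d mulfV.
Qed.

Lemma diag_val a : a != 0 -> exists h : T, val h = diag a.
Proof. by move=> a0; apply: subgroup_val; apply: diag_torus. Qed.

Definition charF theta (a : F) : k := ext0 theta (diag a).

Lemma charF_val theta (h : T) a : val h = diag a -> charF theta a = val (theta h).
Proof. by move=> ha; rewrite /charF -ha ext0_val. Qed.

Lemma diagM a b : a != 0 -> b != 0 -> diag (a * b) = (diag a * diag b)%g.
Proof.
move=> a0 b0; have ab0 := mulf_neq0 a0 b0.
by apply: SL2P; rewrite !(entryE, diagE a0, diagE b0, diagE ab0); field; rewrite ?a0 ?b0.
Qed.

Lemma charF_mult theta : mult_char (charF theta).
Proof.
split=> [a b a0 b0|a a0].
  have [h hb] := diag_val b0.
  by rewrite /charF diagM // -hb ext0Mr ext0_val.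
by rewrite /charF ext0_neq0 diag_torus.
Qed.

Lemma charF_triv a : a != 0 -> charF (triv_char k T) a = 1.
Proof. by move=> a0; have [h ha] := diag_val a0; rewrite (charF_val _ ha). Qed.

Lemma diag_conj a : a != 0 -> (diag a ^ S)%g = diag a^-1.
Proof. by move=> a0; rewrite conjgE diag_sdot // mulKg. Qed.

Lemma charF_twist theta a : a != 0 -> charF (twist_s theta) a = (charF theta a)^-1.
Proof.
move=> a0; have [h ha] := diag_val a0.
rewrite (charF_val _ ha) -(mult_charV (charF_mult theta)) //.
rewrite (@charF_val _ (torus_s h)) //=.
by rewrite ha diag_conj.
Qed.

Lemma charF_nontrivial theta : ~ (theta =1 triv_char k T) -> nontrivial (charF theta).
Proof.
move=> nt; apply: contrapT => h; apply: nt => t; apply: val_inj.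
have [t0 tE] := torus_dg (valP t).
rewrite -(charF_val theta tE); apply: contrapT => /eqP ne; apply: h.
by exists (val (val t) 0 0).
Qed.

(** The character of B is inflated from T, so its value at g depends only on the
    upper left entry. *)
Lemma ext0_inflate theta : ext0 (inflate theta) =1 borel_coef (charF theta).
Proof.
move=> g; rewrite /borel_coef -borelE; have [gB|gB] := boolP (g \in @borel F); last first.
  by rewrite ext0_out.
have [b bE] : exists b : B, val b = g by apply: subgroup_val.
case: g / bE gB => gB; have [p0 _] := borel_decomp (eqP gB).
rewrite ext0_val; apply/esym; apply: charF_val.
apply: SL2P; rewrite !(diagE p0) //= !mx2E //.
by apply: (mulfI p0); rewrite mulfV // -[RHS](SL2_detE (val b)) (eqP gB) mulr0 subr0.
Qed.

Lemma eq_borel_coef th th' : (forall a, a != 0 -> th a = th' a) ->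
  borel_coef (k := k) th =1 borel_coef th'.
Proof.
move=> e g; rewrite /borel_coef; case: eqP => // r0.
by have [p0 _] := borel_decomp r0; apply: e.
Qed.

Section Transfer.
Variables (V W : lmodType kG) (f : {linear V -> W}) (v : V).

Lemma eigenvector_map th : eigenvector th v -> eigenvector th (f v).
Proof. by move=> hv a a0; rewrite -!linearZ hv. Qed.

End Transfer.

Lemma eigenvector_eq th th' (V : lmodType kG) (v : V) :
  (forall a, a != 0 -> th a = th' a) -> eigenvector th v -> eigenvector th' v.
Proof. by move=> e hv a a0; rewrite hv // e. Qed.

Lemma eigenvector_sdotV th (V : lmodType kG) (v : V) : mult_char th ->
  eigenvector th v -> eigenvector (fun t => (th t)^-1) (S^-1%g ** v).
Proof.
move=> thP hv a a0; have e : (diag a * S^-1)%g = (S^-1 * diag a^-1)%g.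
  have aV0 : a^-1 != 0 by rewrite invr_eq0.
  apply: (@mulIg _ S); rewrite mulgVK -mulgA diag_sdot // invrK mulKg //.
by rewrite geltZ e -geltZ hv ?invr_eq0 // (mult_charV thP) // scaler_scalC.
Qed.

Lemma gen_eigenvector theta : eigenvector (charF theta) (ind_gen (H := T) theta).
Proof.
move=> a a0; have [h ha] := diag_val a0.
by rewrite (charF_val _ ha) -ha ind_gen_char.
Qed.

Lemma Mtheta_gen_borel theta (b : SL2) : val b 1 0 = 0 ->
  b ** (ind_gen (H := B) (inflate theta)) =
  scal (charF theta (val b 0 0)) *: ind_gen (H := B) (inflate theta).
Proof.
move=> b10; have bB : b \in @borel F by apply/eqP.
have [h hE] : exists h : B, val h = b by apply: subgroup_val.
rewrite -hE ind_gen_char -ext0_val ext0_inflate /borel_coef hE.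
by rewrite b10 eqxx.
Qed.

Lemma Mtheta_gen_eigen theta : eigenvector (charF theta) (ind_gen (H := B) (inflate theta)).
Proof. by move=> a a0; rewrite Mtheta_gen_borel !diagE. Qed.

Lemma Mtheta_gen_upper theta x :
  upper x ** (ind_gen (H := B) (inflate theta)) = ind_gen (H := B) (inflate theta).
Proof.
rewrite Mtheta_gen_borel !upperE // (mult_char1 (charF_mult theta)) rmorph1 scale1r //.
Qed.

Lemma Mtheta_coef theta (a : kG) : a *: ind_gen (H := B) (inflate theta) != 0 ->
  exists g, pairing (borel_coef (charF theta)) (gelt k g * a) != 0.
Proof.
move=> /ind_coef_neq0[g ga]; exists g.
by rewrite -(eq_pairing (ext0_inflate theta)).
Qed.

End TorusCharacters.

(** * Principal series modules for inverse characters *)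

Section Nonisomorphism.
Variables (F : closedFieldType) (k : fieldType).
Local Notation SL2 := (SL2 F).
Local Notation kG := (galg k SL2).
Local Notation "g ** v" := (gelt k g *: v) (at level 36, right associativity, only parsing).
Local Notation S := (sdot F).
Local Notation T := (torus_group F).
Local Notation B := (borel_group F).

Lemma pairing_borel_coef_borel (theta : {multiplicative T -> Gm k}) (b : SL2) (a : kG) :
  val b 1 0 = 0 ->
  pairing (borel_coef (charF theta)) (gelt k b * a) =
  borel_coef (charF theta) b * pairing (borel_coef (charF theta)) a.
Proof.
move=> b10; rewrite pairing_mul pairing_gelt -!ext0_inflate.
have [h <-] : exists h : B, val h = b by apply: subgroup_val; apply/eqP.
rewrite -!(eq_pairing (ext0_inflate theta)) ext0_val.
elim/galg_ind: a => [|a1 a2 IH1 IH2|c g]; first by rewrite !raddf0 mulr0.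
  by rewrite !raddfD /= IH1 IH2 mulrDr.
by rewrite !pairing_scal !pairing_gelt -ext0_inflate ext0Ml mulrCA.
Qed.

(** For each g at most one x puts s u_x g into the Borel subgroup. *)
Lemma cofinite_borel_coef (th : F -> k) (a : kG) :
  exists l : seq F, forall x, x \notin l ->
    pairing (borel_coef th) (gelt k (S * upper x)%g * a) = 0.
Proof.
elim/galg_ind: a => [|a1 a2 [l1 h1] [l2 h2]|c g].
- by exists [::] => x _; rewrite mulr0 raddf0.
- exists (l1 ++ l2) => x; rewrite mem_cat negb_or => /andP[x1 x2].
  rewrite mulrDr raddfD /= [X in X + _](h1 x x1).
  by rewrite [X in _ + X](h2 x x2) addr0.
exists [:: - (val g 0 0 / val g 1 0)] => x; rewrite inE => xg.
rewrite -scalCA geltM pairing_scal pairing_gelt /borel_coef ifN ?mulr0 //.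
rewrite !entryE; apply: contra xg => /eqP e.
have e2 : val g 0 0 + x * val g 1 0 = 0 by rewrite -[RHS]oppr0 -e; ring.
have r0 : val g 1 0 != 0.
  apply/eqP => r0; have := SL2_detE g.
  move: e2; rewrite r0 mulr0 addr0 => ->; rewrite mul0r mulr0 subrr => /eqP.
  by rewrite eq_sym oner_eq0.
apply/eqP; apply: (mulIf r0); rewrite mulNr divfK //.
by apply/eqP; rewrite -addr_eq0 addrC e2.
Qed.

(** The coordinate phi of the translates of a U-fixed vector is constant along
    s u_x and vanishes for almost all x, hence for all x.  By the Bruhat decomposition
    it lives on B only, where it transforms under the torus through theta on
    the left and through th on the right. *)
Lemma upper_fixed_eigenvalue (theta : {multiplicative T -> Gm k}) (th : F -> k)
    (W : lmodType kG) (v : W) (a : kG) :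
  (forall b c, b *: v = c *: v ->
     pairing (borel_coef (charF theta)) b = pairing (borel_coef (charF theta)) c) ->
  (exists g, pairing (borel_coef (charF theta)) (gelt k g * a) != 0) ->
  (forall x, upper x ** (a *: v) = a *: v) -> eigenvector th (a *: v) ->
  forall t, t != 0 -> th t = charF theta t.
Proof.
move=> wd nz uw hw; pose phi x := pairing (borel_coef (charF theta)) (gelt k x * a).
have phi_upper x : phi (S * upper x)%g = phi S.
  by apply: wd; rewrite -[LHS]scalerA -[RHS]scalerA -geltZ uw.
have phiS x : phi (S * upper x)%g = 0.
  have [l lP] := cofinite_borel_coef (charF theta) a; have [y yl] := closed_infinite l.
  by rewrite phi_upper -(phi_upper y); apply: lP.
have phi1 : pairing (borel_coef (charF theta)) a != 0.
  have [g] := nz; have [g10|g10] := eqVneq (val g 1 0) 0.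
    by rewrite pairing_borel_coef_borel // mulf_eq0 negb_or => /andP[_].
  (* The matrix s u_y has the same second row as g up to a scalar. *)
  pose y := val g 1 1 / val g 1 0; pose b := (g * (S * upper y)^-1)%g.
  have b10 : val b 1 0 = 0 by rewrite /b !entryE /y; field.
  have -> : gelt k g * a = gelt k b * (gelt k (S * upper y)%g * a).
    by rewrite mulrA geltM mulgVK.
  by rewrite pairing_borel_coef_borel // -/(phi _) phiS mulr0 eqxx.
move=> t t0; apply: (mulIf phi1); rewrite -pairing_scal.
have diag10 : val (diag t) 1 0 = 0 by rewrite diagE.
have <- : borel_coef (charF theta) (diag t) = charF theta t.
  by rewrite /borel_coef !diagE // eqxx.
rewrite -(pairing_borel_coef_borel theta a diag10); apply: wd.
by rewrite -[LHS]scalerA -[RHS]scalerA hw.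
Qed.

Lemma upper_fixed_character (theta : {multiplicative T -> Gm k}) (th : F -> k)
    (w : Mtheta theta) :
  w != 0 -> (forall x, upper x ** w = w) -> eigenvector th w ->
  forall t, t != 0 -> th t = charF theta t.
Proof.
have [a ->] := ind_genP w => /Mtheta_coef nz; apply: upper_fixed_eigenvalue nz.
by move=> b c /pairing_ext0_wd; rewrite !(eq_pairing (ext0_inflate theta)).
Qed.

Lemma Mtheta_twist_noniso (theta : {multiplicative T -> Gm k}) :
  nontrivial (charF theta) -> ~ mod_iso (Mtheta theta) (Mtheta (twist_s theta)).
Proof.
move=> /(nontrivial_sqr (charF_mult theta))[a a0 ta] [f f_bij].
have v0 : f (ind_gen (inflate theta)) != 0.
  rewrite -(raddf0 f) (inj_eq (bij_inj f_bij)); exact: ind_gen_neq0.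
have := upper_fixed_character v0 _ (eigenvector_map f (Mtheta_gen_eigen theta)) a0.
rewrite charF_twist // => e; case/eqP: ta.
rewrite expr2 {1}e ?mulVf ?(mult_char_neq0 (charF_mult theta)) // => x.
by rewrite -linearZ Mtheta_gen_upper.
Qed.

End Nonisomorphism.

(** * Quotients of the induced modules *)

Section Quotients.
Variables (F : closedFieldType) (k : fieldType).
Hypothesis k_char0 : [pchar k] =i pred0.
Hypothesis F_lf : locally_finite F.
Local Notation SL2 := (SL2 F).
Local Notation kG := (galg k SL2).
Local Notation "g ** v" := (gelt k g *: v) (at level 36, right associativity, only parsing).
Local Notation S := (sdot F).
Local Notation T := (torus_group F).
Local Notation B := (borel_group F).
Local Notation N := (ntorus_group F).

Lemma torus_normalizes (A : SL2) : A \in @torus F -> A \in normalizer (@torus F).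
Proof.
move=> AT; have [T1 TD] := @torus_group_closed F.
have TV (X : SL2) : X \in @torus F -> X^-1%g \in @torus F.
  by move=> XT; rewrite -[X^-1%g]mul1g TD.
apply/asboolP => y; rewrite conjgE torus_mul; last exact: TV.
apply/idP/idP => [h|yT]; last by rewrite -[A]invgK TD // TV.
by rewrite -(mulgK A y) TD.
Qed.

Section NormalizerCharacter.
Variable chi : {multiplicative N -> Gm k}.
Hypothesis chi_torus : forall h : N, val h \in @torus F -> chi h = 1%g.

Lemma gen_trivial_eigen : eigenvector (@trivial_char F k) (ind_gen (H := N) chi).
Proof.
move=> a a0; have [h hE] : exists h : N, val h = diag a.
  by apply: subgroup_val; apply: torus_normalizes; apply: diag_torus.
by rewrite -hE ind_gen_char chi_torus // hE diag_torus.
Qed.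

Lemma gen_sdot (e : k) : (forall h : N, val h \notin @torus F -> val (chi h) = e) ->
  S ** ind_gen (H := N) chi = scal e *: ind_gen (H := N) chi.
Proof.
move=> he; have [h hE] : exists h : N, val h = S.
  by apply: subgroup_val; apply: sdot_normalizes.
rewrite -hE ind_gen_char he // hE; apply/torusP => -[].
by rewrite sdotE => /eqP; rewrite oner_eq0.
Qed.

End NormalizerCharacter.

Section QuotientMembership.
Variables (M : lmodType kG) (Y : submodClosed M) (w : M).

Lemma quot_eigenvector th : eigenvector th w -> eigenvector th (quot_proj Y w).
Proof. exact: (eigenvector_map (quot_proj Y)). Qed.

Lemma quot_annihilator (a b : kG) : a *: w \in Y -> (b * a) *: quot_proj Y w = 0.
Proof.
by move=> aY; rewrite -linearZ; apply/quot_proj_eq0; rewrite -scalerA rpredZ.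
Qed.

Lemma quot_fixed (M' : lmodType kG) (f : {linear M -> M'}) (g : SL2) :
  {subset ker f <= Y} -> g ** f w = f w -> g ** quot_proj Y w = quot_proj Y w.
Proof.
move=> kY fw; rewrite -linearZ; apply/quot_projP/kY.
by rewrite kerE raddfB /= linearZ /= fw subrr.
Qed.

End QuotientMembership.

Theorem IndN_plus_quotient : exists X : submodClosed (IndN_plus F k),
  [/\ maximal_submod X,
      forall Y : submodClosed (IndN_plus F k), maximal_submod Y -> Y =i X,
      simple_mod (quot_mod X) & mod_iso (quot_mod X) (triv_mod F k)].
Proof.
pose w : IndN_plus F k := ind_gen (triv_char k N).
have [h|f fw] := @ind_map _ _ _ N (triv_char k N) (triv_mod F k) (1 : k).
  by rewrite gelt_scaleE char_scalE.
have fE a : f (a *: w) = pairing (fun=> 1) a :> k.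
  by rewrite linearZ /= fw -[LHS]/(pairing (fun=> 1) a * 1) mulr1.
have w_eigen := gen_trivial_eigen (chi := triv_char k N) (fun _ _ => erefl).
have Sw : S ** w = w.
  by rewrite (gen_sdot (e := 1)) ?rmorph1 ?scale1r.
apply: (largest_kernel (f := f) (w := w)).
- exact: ind_genP.
- by rewrite fw oner_neq0.
- move=> c; exists (scal (c : k) *: w).
  by rewrite fE pairing_of_scal mulr1.
move=> Y m; have [a ->] := ind_genP m => aY; rewrite fE => aug.
apply/quot_proj_eq0; apply: (plus_vanishing k_char0 F_lf) aug.
- exact: quot_eigenvector.
- by rewrite -linearZ Sw.
by have := quot_annihilator 1 aY; rewrite mul1r.
Qed.

Lemma eta_s_eigen : eigenvector (@trivial_char F k) (eta_s F k).
Proof.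
have one_eigen : eigenvector (@trivial_char F k) (one_tr F k).
  apply: eigenvector_eq (Mtheta_gen_eigen (triv_char k T)) => a a0.
  exact: charF_triv.
move=> a a0; rewrite /eta_s scalerBl scale1r scalerBr one_eigen //.
rewrite (eigenvector_sdot (@trivial_mult_char F k)) //.
by rewrite /trivial_char invr1 !rmorph1 !scale1r.
Qed.

Lemma eta_s_sdot : S ** eta_s F k = - eta_s F k.
Proof.
have SS : (S * S)%g = diag (-1).
  have m10 : -1 != 0 :> F by rewrite oppr_eq0 oner_eq0.
  by apply: SL2P; rewrite !(entryE, diagE m10); field; rewrite ?oner_neq0.
rewrite /eta_s scalerBl scale1r scalerBr opprB geltZ SS; congr (_ - _).
rewrite Mtheta_gen_eigen ?charF_triv ?oppr_eq0 ?oner_eq0 //.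
by rewrite rmorph1 scale1r.
Qed.

(** Right multiplication by s exchanges the Borel type and the type U T s. *)
Lemma eta_s_coef (a : kG) : a *: eta_s F k != 0 ->
  exists g, pairing (borel_coef (@trivial_char F k)) (gelt k g * a)
          - pairing (weyl_coef (@trivial_char F k)) (gelt k g * a) != 0.
Proof.
rewrite /eta_s scalerA => /Mtheta_coef[g ga]; exists g.
rewrite (eq_pairing (eq_borel_coef (@charF_triv F k))) (mulrA (gelt k g) a) in ga.
rewrite pairing_mul_1B in ga; apply: contra_neq ga => <-; congr (_ - _).
apply: eq_pairing => h; rewrite /borel_coef /weyl_coef !entryE.
by rewrite /trivial_char invr1 mulr0 add0r mulrN1 oppr_eq0.
Qed.

Lemma eta_s_neq0 : eta_s F k != 0.
Proof.
apply/eqP => e; have := @pairing_ext0_wd _ _ _ B (inflate (triv_char k T))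
   (1 - gelt k S) 0; rewrite -/(one_tr F k) scale0r => /(_ e).
rewrite raddf0 raddfB /= -[1]/(gelt k 1%g) !pairing_gelt !ext0_inflate /borel_coef.
rewrite !mxE /= !entryE oppr_eq0 oner_eq0 eqxx subr0 charF_triv ?oner_neq0 //.
by move/eqP; rewrite oner_eq0.
Qed.

(** The vectors [a *: eta_s] already form a submodule. *)
Lemma St_generated (x : Steinberg F k) : exists a : kG, val x = a *: eta_s F k.
Proof.
have /asboolP := valP x.
pose P : {pred Mtheta (triv_char k T)} :=
  fun y => `[< exists a, y = a *: eta_s F k >].
pose PI := GRing.isSubmodClosed.Build _ _ P (orbit_submod_closed (eta_s F k)).
pose PP : submodClosed (Mtheta (triv_char k T)) := HB.pack P PI.
move=> /(_ PP) h; suff /asboolP : val x \in PP by [].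
apply: h => _ ->; apply/asboolP; exists 1; by rewrite scale1r.
Qed.

Lemma eta_s_St : eta_s F k \in submod_pred (@St_pred F k).
Proof. by apply/asboolP => X; apply. Qed.

Lemma sgn_torus (h : N) : val h \in @torus F -> sgn_char F k h = 1%g.
Proof. by move=> hT; rewrite /sgn_char /= /sgn_fun hT. Qed.

Lemma sgn_ntorus (h : N) : val h \notin @torus F -> val (sgn_char F k h) = -1.
Proof. by move=> hT; rewrite /sgn_char /= /sgn_fun (negbTE hT). Qed.

Lemma sgn_eigenvector (V : lmodType kG) (v : V) (h : N) :
  eigenvector (@trivial_char F k) v -> S ** v = - v ->
  gelt k (val h) *: v = scal (val (sgn_char F k h)) *: v.
Proof.
move=> hv Sv; have [hT|hT] := boolP (val h \in @torus F).
  by have [t0 ->] := torus_dg hT; rewrite hv // sgn_torus.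
have [h00 h11] := ntorusP (valP h) hT; have [_ q0 ->] := coborel_decomp h11.
rewrite h00 mul0r oppr0 upper0 mul1g -geltZ Sv scalerN hv //.
by rewrite sgn_ntorus // rmorph1 scale1r rmorphN1 scaleN1r.
Qed.

Lemma St_valZ (a : kG) (x : Steinberg F k) : val (a *: x) = a *: val x.
Proof. exact: sub_mod_valZ. Qed.

Lemma St_val_neq0 (x : Steinberg F k) : x != 0 -> val x != 0.
Proof. by apply: contra => /eqP x0; apply/eqP/val_inj. Qed.

Theorem IndN_minus_quotient : exists X : submodClosed (IndN_minus F k),
  [/\ maximal_submod X,
      forall Y : submodClosed (IndN_minus F k), maximal_submod Y -> Y =i X,
      simple_mod (quot_mod X) & mod_iso (quot_mod X) (Steinberg F k)].
Proof.
pose w : IndN_minus F k := ind_gen (sgn_char F k).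
pose eta : Steinberg F k := Sub (eta_s F k) eta_s_St.
have [h|f fw] := @ind_map _ _ _ N (sgn_char F k) (Steinberg F k) eta.
  apply: val_inj; apply: etrans (St_valZ _ _) (etrans _ (esym (St_valZ _ _))).
  exact: (sgn_eigenvector h eta_s_eigen eta_s_sdot).
have w_eigen := gen_trivial_eigen sgn_torus.
have Sw : S ** w = - w by rewrite (gen_sdot sgn_ntorus) rmorphN1 scaleN1r.
have fE a : val (f (a *: w)) = a *: eta_s F k by rewrite linearZ fw.
apply: (largest_kernel (f := f) (w := w)).
- exact: ind_genP.
- by rewrite fw -(inj_eq val_inj) /= eta_s_neq0.
- move=> x; have [a xa] := St_generated x; exists (a *: w); apply: val_inj.
  by rewrite fE.
move=> Y m; have [a ->] := ind_genP m => aY fa.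
have := St_val_neq0 fa; rewrite (fE a) => /eta_s_coef[g ga].
apply/quot_proj_eq0; apply: (minus_vanishing k_char0 F_lf) ga.
- exact: quot_eigenvector.
- by rewrite -linearZ Sw linearN.
exact: (quot_annihilator (gelt k g) aY).
Qed.

Lemma eigenvector_torus (theta : {multiplicative T -> Gm k}) (V : lmodType kG)
    (v : V) (h : T) : eigenvector (charF theta) v ->
  gelt k (val h) *: v = scal (val (theta h)) *: v.
Proof.
by move=> hv; have [h0 hE] := torus_dg (valP h); rewrite [in LHS]hE hv // (charF_val _ hE).
Qed.

Lemma generator_surj (M1 M2 : lmodType kG) (f : {linear M1 -> M2}) w :
  (forall n, exists a : kG, n = a *: f w) -> forall n, exists m, f m = n.
Proof. by move=> gen n; have [a ->] := gen n; exists (a *: w); rewrite linearZ. Qed.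

Lemma generator_translate (V : lmodType kG) (v : V) (g : SL2) :
  (forall n, exists a : kG, n = a *: v) -> forall n, exists a : kG, n = a *: (g ** v).
Proof.
move=> gen n; have [a ->] := gen n; exists (a * gelt k g^-1%g).
by rewrite -scalerA geltZ mulVg gelt1Z.
Qed.

Lemma sdotVK (V : lmodType kG) (v : V) : S ** S^-1%g ** v = v.
Proof. by rewrite geltZ mulgV gelt1Z. Qed.

Lemma sdotKV (V : lmodType kG) (v : V) : S^-1%g ** S ** v = v.
Proof. by rewrite geltZ mulVg gelt1Z. Qed.

Lemma quot_sdotVK (V : lmodType kG) (Y : submodClosed V) (v : V) :
  quot_proj Y v = S ** quot_proj Y (S^-1%g ** v).
Proof. by rewrite -linearZ sdotVK. Qed.

Lemma mem_sdotV (V : lmodType kG) (Y : submodClosed V) (v : V) :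
  S^-1%g ** v \in Y -> v \in Y.
Proof. by move=> vY; rewrite -(sdotVK v) rpredZ. Qed.

Lemma sdot_unshift (V : lmodType kG) (v : V) (a b : kG) :
  (b * (a * gelt k S)) *: (S^-1%g ** v) = b *: (a *: v).
Proof. by rewrite -scalerA -scalerA sdotVK. Qed.

Lemma quot_annihilator_sdot (V : lmodType kG) (Y : submodClosed V) (v : V)
    (a b : kG) : a *: v \in Y ->
  (b * (a * gelt k S)) *: quot_proj Y (S^-1%g ** v) = 0.
Proof.
by move=> aY; rewrite -linearZ; apply/quot_proj_eq0; rewrite sdot_unshift rpredZ.
Qed.

(** A map Ind_T k_theta -> M is a theta-eigenvector of the torus in M; the two
    quotient maps are given by 1_theta and by s 1_(theta^s).  In a quotient by Y
    with w the image of the generator, [borel_vanishing] applied to w and to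
    s^-1 w gives the maximality of the two kernels.  A submodule contained in
    neither kernel provides the two relations of [torus_vanishing]. *)
Theorem IndT_quotients (theta : {multiplicative T -> Gm k}) :
  ~ (theta =1 triv_char k T) ->
  exists X1 X2 : submodClosed (IndT theta),
  [/\ ~ (X1 =i X2),
      simple_mod (quot_mod X1) /\ simple_mod (quot_mod X2),
      forall Y : submodClosed (IndT theta),
        simple_mod (quot_mod Y) -> Y =i X1 \/ Y =i X2,
      mod_iso (quot_mod X1) (Mtheta theta)
        /\ mod_iso (quot_mod X2) (Mtheta (twist_s theta))
    & ~ mod_iso (Mtheta theta) (Mtheta (twist_s theta))].
Proof.
move=> /charF_nontrivial nt; pose th := charF theta.
have thP : mult_char th := charF_mult theta.
pose th' t := (th t)^-1; have th'P : mult_char th' := inv_mult_char thP.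
pose w : IndT theta := ind_gen theta.
pose v1 : Mtheta theta := ind_gen (inflate theta).
pose v2 : Mtheta (twist_s theta) := ind_gen (inflate (twist_s theta)).
have w_gen : forall m, exists a, m = a *: w by exact: ind_genP.
have w_eigen : eigenvector th w by exact: gen_eigenvector.
have v2_eigen : eigenvector th' v2.
  apply: eigenvector_eq (Mtheta_gen_eigen (twist_s theta)) => a a0.
  exact: charF_twist.
have th'K a : (th' a)^-1 = th a by rewrite invrK.
have Sv2_eigen : eigenvector th (S ** v2).
  apply: eigenvector_eq (eigenvector_sdot th'P v2_eigen) => a _; exact: th'K.
have [h|f1 f1w] := @ind_map _ _ _ T theta _ v1.
  exact: (eigenvector_torus h (Mtheta_gen_eigen theta)).
have [h|f2 f2w] := @ind_map _ _ _ T theta _ (S ** v2).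
  exact: (eigenvector_torus h Sv2_eigen).
have f1_surj : forall n, exists m, f1 m = n.
  by apply: (generator_surj (w := w)); rewrite f1w; apply: ind_genP.
have f2_surj : forall n, exists m, f2 m = n.
  apply: (generator_surj (w := w)); rewrite f2w.
  by apply: generator_translate; apply: ind_genP.
have f1_neq0 : f1 w != 0 by rewrite f1w; apply: ind_gen_neq0.
have f2_neq0 : f2 w != 0.
  rewrite f2w; apply: contra (ind_gen_neq0 (inflate (twist_s theta))).
  by move=> /eqP/gelt_eq0/eqP.
have coef1 a : f1 (a *: w) != 0 ->
    exists g, pairing (borel_coef th) (gelt k g * a) != 0.
  by rewrite linearZ /= f1w; apply: Mtheta_coef.
have coef2 a : f2 (a *: w) != 0 ->
    exists g, pairing (borel_coef th') (gelt k g * (a * gelt k S)) != 0.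
  rewrite linearZ /= f2w scalerA => /Mtheta_coef[g ga]; exists g.
  by rewrite -(eq_pairing (eq_borel_coef (@charF_twist F k theta))).
have max1 : maximal_submod (ker f1).
  apply: (ker_maximal w_gen f1_neq0) => Y kY m.
  have [a ->] := w_gen m => aY /coef1[g ga].
  apply/quot_proj_eq0; apply: (borel_vanishing k_char0 F_lf thP nt) ga.
  - exact: quot_eigenvector.
  - by move=> x; apply: (quot_fixed kY); rewrite f1w; apply: Mtheta_gen_upper.
  exact: (quot_annihilator (gelt k g) aY).
have S_eigen (Y : submodClosed (IndT theta)) : eigenvector th' (quot_proj Y (S^-1%g ** w)).
  by apply: quot_eigenvector; apply: eigenvector_sdotV.
have f2Sw : f2 (S^-1%g ** w) = v2.
  by rewrite linearZ f2w; apply: sdotKV.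
have max2 : maximal_submod (ker f2).
  apply: (ker_maximal w_gen f2_neq0) => Y kY m.
  have [a ->] := w_gen m => aY /coef2[g ga].
  apply: mem_sdotV; apply/quot_proj_eq0.
  apply: (borel_vanishing k_char0 F_lf th'P (nontrivialV nt)) ga.
  - exact: S_eigen.
  - by move=> x; apply: (quot_fixed kY); rewrite f2Sw; apply: Mtheta_gen_upper.
  exact: (quot_annihilator_sdot (gelt k g) aY).
have noniso := Mtheta_twist_noniso nt.
exists (ker f1), (ker f2); split; last exact: noniso.
- move=> e12; apply: noniso; apply: (same_kernel_iso f1_surj f2_surj).
  exact: ker_eqP.
- by split; [move/simple_quotP: max1 | move/simple_quotP: max2].
- move=> Y /simple_quotP maxY.
  have [[m1 m1Y f1m]|Y1] := pselect (exists2 m, m \in Y & f1 m != 0); last first.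
    by left; exact: (maximal_sub_ker f1_neq0 maxY Y1).
  have [[m2 m2Y f2m]|Y2] := pselect (exists2 m, m \in Y & f2 m != 0); last first.
    by right; exact: (maximal_sub_ker f2_neq0 maxY Y2).
  have [a1 m1E] := w_gen m1; have [a2 m2E] := w_gen m2.
  rewrite m1E in m1Y f1m; rewrite m2E in m2Y f2m.
  have [g1 c1] := coef1 _ f1m; have [g2 c2] := coef2 _ f2m.
  have wY : quot_proj Y w = 0.
    apply: (torus_vanishing k_char0 F_lf thP nt _ (S_eigen Y) _ _ c1 _ c2).
    - exact: quot_eigenvector.
    - exact: quot_sdotVK.
    - exact: (quot_annihilator (gelt k g1) m1Y).
    exact: (quot_annihilator_sdot (gelt k g2) m2Y).
  have [[x xY] _] := maxY; case/negP: xY.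
  by rewrite (gen_mem w_gen) //; apply/quot_proj_eq0.
by split; apply: quot_ker_iso.
Qed.

End Quotients.

Theorem theorem3p1 (Fq : finFieldType) (Fbar : closedFieldType)
    (iota : {rmorphism Fq -> Fbar})
    (Fbar_algebraic : forall x : Fbar, algebraicOver iota x)
    (k : closedFieldType) (k_char0 : [pchar k] =i pred0) :
  [/\ exists X : submodClosed (IndN_plus Fbar k),
        [/\ maximal_submod X,
            forall Y : submodClosed (IndN_plus Fbar k),
              maximal_submod Y -> Y =i X,
            simple_mod (quot_mod X)
          & mod_iso (quot_mod X) (triv_mod Fbar k)],
      exists X : submodClosed (IndN_minus Fbar k),
        [/\ maximal_submod X,
            forall Y : submodClosed (IndN_minus Fbar k),
              maximal_submod Y -> Y =i X,
            simple_mod (quot_mod X)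
          & mod_iso (quot_mod X) (Steinberg Fbar k)]
    & forall theta : {multiplicative torus_group Fbar -> Gm k},
        ~ (theta =1 triv_char k (torus_group Fbar)) ->
        exists X1 X2 : submodClosed (IndT theta),
        [/\ ~ (X1 =i X2),
            simple_mod (quot_mod X1) /\ simple_mod (quot_mod X2),
            forall Y : submodClosed (IndT theta),
              simple_mod (quot_mod Y) -> Y =i X1 \/ Y =i X2,
            mod_iso (quot_mod X1) (Mtheta theta)
              /\ mod_iso (quot_mod X2) (Mtheta (twist_s theta))
          & ~ mod_iso (Mtheta theta) (Mtheta (twist_s theta))]].
Proof.
have F_lf := algebraic_locally_finite Fbar_algebraic.
split; first exact: IndN_plus_quotient.
  exact: IndN_minus_quotient.
exact: IndT_quotients.
Qed.
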